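(* Every irrational real number $\xi$ with $\mu(\xi)<\frac53+\frac{4}{15}\sqrt{10}$ satisfies $\lim_{n\to\infty}\big(p(n,\xi,b)-n\big)=+\infty$ for every integer $b\ge2$. Furthermore, for every integer $b\ge2$ there exists an irrational real number $\xi_b$ with $\mu(\xi_b)=\frac53+\frac4{15}\sqrt{10}$ and $p(n,\xi_b,b)=n+1$ for all $n\ge1$.
   Context: For an integer $b\ge2$, every real $\xi$ is uniquely written $\xi=\lfloor\xi\rfloor+\sum_{\ell\ge1}a_\ell b^{-\ell}$ with digits $a_\ell\in\{0,\ldots,b-1\}$ and $a_\ell\ne b-1$ for infinitely many $\ell$; $p(n,\xi,b)=\#\{a_{\ell+1}a_{\ell+2}\cdots a_{\ell+n}:\ell\ge0\}$. The irrationality exponent $\mu(\xi)$ is the supremum of the real $\mu$ such that $|\xi-p/q|<q^{-\mu}$ has infinitely many rational solutions $p/q$. *)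

(* Defs.v *)
From HB Require Import structures.
From mathcomp Require Import all_boot all_order all_algebra.
From mathcomp Require Import all_classical all_reals all_analysis.
Set Implicit Arguments. Unset Strict Implicit. Unset Printing Implicit Defensive.
Import Order.TTheory GRing.Theory Num.Theory.
Local Open Scope ring_scope.
Local Open Scope classical_set_scope.

(* l-th base-b digit (l >= 1) of xi: a_l = floor(b^l xi) - b * floor(b^(l-1) xi).
   This is the expansion with a_l <> b-1 for infinitely many l. *)
Definition digit {R : realType} (xi : R) (b l : nat) : nat :=
  absz (Num.floor (b%:R ^+ l * xi) - b%:Z * Num.floor (b%:R ^+ l.-1 * xi))%R.

(* p(n, xi, b): number of distinct blocks a_(l+1) ... a_(l+n), l >= 0.
   Digits lie in {0,..,b-1}, so blocks are encoded as n-tuples over 'I_b. *)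
Definition complexity {R : realType} (n : nat) (xi : R) (b : nat) : nat :=
  #|[set w : n.-tuple 'I_b |
      `[< exists l : nat, forall i : 'I_n,
            (tnth w i : nat) = digit xi b (l + i + 1) >] ]|.

Definition irrationality_exponent {R : realType} (xi : R) : \bar R :=
  ereal_sup [set mu%:E | mu in
    [set mu : R | ~ finite_set
       [set r : rat | `| xi - ratr r | < ((denq r)%:~R : R) `^ (- mu)] ] ].

(* Main.v *)
(* If the digits of [xi] satisfy x_(i+t) = x_(i+d+t) for t < N, then [xi] is within
   b^-(i+d+N) of a rational of denominator at most b^(i+d), up to constants; so what
   matters is how large N can be compared with J = i+d.

   When p(n) - n stays bounded, p(n+1) = p(n) + 1 eventually, and return words to the
   unique right special word cut the digits into two kinds of blocks, of lengths a (the
   first one) and b, whose order is again a Sturmian word.  One of the two blocks is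
   isolated, so that the coding can be renormalised.  Let P and S be the lengths of the
   longest common extensions of two block boundaries to the right and to the left;
   P + S - a - b is constant.  Renormalisation acts on (a, b, P) by one of three moves
     X : (a+b, b, P)     Y : (a, a+b, P+a)     Z : (a+b, a, P+a),
   and each stage provides repetitions with (J, N) = (a, P) and, unless the move is Y,
   (J, N) = (b, a+P) or (P, a+b).  If N / J < 151/100 at all late stages, linear
   arithmetic on windows of eight stages forces the moves to be periodic of period XZZZ.
   Along this period 3P - 2a - 4b and |2a^2 - 5b^2| are constant, so P / a tends to
   2/3 + 4/15 sqrt 10.

   The extremal number has as digits the fixed point of the substitution
   1 -> 10010100, 0 -> 10010, which is the word with all moves XZZZ.  Six repetitions per
   period give so many rational approximations that, at each scale, two distinct ones
   keep every other rational away from [xi]. *)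
Require Import Defs.
From HB Require Import structures.
From mathcomp Require Import all_boot all_order all_algebra.
From mathcomp Require Import all_classical all_reals all_analysis.
From mathcomp Require Import zify ring lra.
Set Implicit Arguments. Unset Strict Implicit. Unset Printing Implicit Defensive.
Import Order.TTheory GRing.Theory Num.Theory.

(** * Block structures and their renormalisation *)

Definition agree (T : Type) (z : nat -> T) (i j n : nat) :=
  forall t, t < n -> z (i + t) = z (j + t).

(* [z] is the concatenation of blocks of lengths [a] (coded by [true] in [y]) and [b];
   the [k]-th block starts at [e k].  [P] and [S] only need to bound from below the
   common extensions of two boundaries; on the left these are cut off at the origin. *)
Record blocks (T : Type) (z : nat -> T) (a b P S : nat)
    (y : nat -> bool) (e : nat -> nat) : Prop := Blocks {
  bl_start : e 0 = 0;
  bl_step : forall k, e k.+1 = e k + (if y k then a else b);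
  bl_eq : forall k k', y k = y k' -> agree z (e k) (e k') (if y k then a else b);
  bl_right : forall k k', agree z (e k) (e k') P;
  bl_left : forall k k' t, t < S -> t < e k -> t < e k' ->
    z (e k - t.+1) = z (e k' - t.+1) }.

(* For no word [s] are all of 1s1, 1s0, 0s1, 0s0 factors of [y], that is, [y] has at most
   one right special factor of each length. *)
Definition balanced (y : nat -> bool) := forall n i j i' j',
  y i = true -> y j = true -> y i' = false -> y j' = false ->
  agree y i.+1 j.+1 n -> agree y i.+1 i'.+1 n -> agree y i.+1 j'.+1 n ->
  y (i.+1 + n) = true -> y (j.+1 + n) = false ->
  y (i'.+1 + n) = true -> y (j'.+1 + n) = false -> False.

Section Agree.
Variable T : Type.
Implicit Types z : nat -> T.

Lemma agree_sym z i j n : agree z i j n -> agree z j i n.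
Proof. by move=> h t tn; rewrite h. Qed.

Lemma agree_trans z i j k n : agree z i j n -> agree z j k n -> agree z i k n.
Proof. by move=> h1 h2 t tn; rewrite h1 ?h2. Qed.

Lemma agree_le z i j m n : m <= n -> agree z i j n -> agree z i j m.
Proof. by move=> mn h t tm; apply: h; lia. Qed.

Lemma agree_cat z i j m n :
  agree z i j m -> agree z (i + m) (j + m) n -> agree z i j (m + n).
Proof.
move=> h1 h2 t tmn; case: (ltnP t m) => tm; first exact: h1.
have := h2 (t - m); rewrite -!addnA subnKC //; apply; lia.
Qed.

Lemma agree_shift z i j m n :
  agree z i j (m + n) -> agree z (i + m) (j + m) n.
Proof. by move=> h t tn; rewrite -!addnA h //; lia. Qed.

Lemma agree_cast z i j n i' j' n' :
  agree z i j n -> i = i' -> j = j' -> n = n' -> agree z i' j' n'.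
Proof. by move=> h <- <- <-. Qed.

End Agree.

Section Blocks.
Variables (T : Type) (z : nat -> T) (a b P S : nat).
Variables (y : nat -> bool) (e : nat -> nat).
Hypothesis B : blocks z a b P S y e.

Lemma blocks_mono k n : e k <= e (k + n).
Proof. by elim: n => [|n IH]; rewrite ?addn0 // addnS (bl_step B); lia. Qed.

(** Equal stretches of the code spell equal stretches of [z], prolonged by the [P] letters that any
    two boundaries share. The first conjunct, written without subtraction, compares the two
    lengths. *)
Lemma blocks_agree k k' n : agree y k k' n ->
  e (k + n) + e k' = e (k' + n) + e k /\
  agree z (e k) (e k') (e (k + n) - e k + P).
Proof.
elim: n k k' => [|n IH] k k' h.
  rewrite !addn0 subnn add0n; split; [lia | exact: (bl_right B)].
have h0 : y k = y k' by have := h 0 isT; rewrite !addn0.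
have [|IH1 IH2] := IH k.+1 k'.+1.
  by move=> t tn; have := h t.+1; rewrite !addnS !addSn; apply.
rewrite !addnS -!addSn.
have s1 := bl_step B k; have s2 := bl_step B k'; rewrite -h0 in s2.
have m := blocks_mono k.+1 n.
split; first by lia.
have -> : e (k.+1 + n) - e k + P =
  (if y k then a else b) + (e (k.+1 + n) - e k.+1 + P) by lia.
by apply: agree_cat; [exact: (bl_eq B) | rewrite -s1 -s2].
Qed.

Lemma blocks_swap : blocks z b a P S (fun k => ~~ y k) e.
Proof.
case: B => h0 h1 h2 h3 h4; split => //.
- by move=> k; rewrite h1; case: (y k).
- move=> k k' /(congr1 negb); rewrite !negbK => /h2.
  by case: (y k).
Qed.

End Blocks.

Lemma agree_negb y i j n : agree (fun k => ~~ y k) i j n -> agree y i j n.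
Proof. by move=> h t tn; apply: negb_inj; apply: h. Qed.

Lemma balanced_swap y : balanced y -> balanced (fun k => ~~ y k).
Proof.
move=> h n i j i' j' hi hj hi' hj' A1 A2 A3 ei ej ei' ej'.
move: A1 A2 A3 => /agree_negb A1 /agree_negb A2 /agree_negb A3.
apply: (h n j' i' j i);
  try by apply: negb_inj; first [rewrite hi|rewrite hj|rewrite hi'|rewrite hj'|
    rewrite ei|rewrite ej|rewrite ei'|rewrite ej'].
- by apply: (agree_trans (agree_sym A3)).
- by apply: (agree_trans (agree_sym A3)).
- exact: agree_sym.
Qed.

Section Moves.
Variables (T : Type) (z : nat -> T) (a b P S : nat).
Variables (y : nat -> bool) (e : nat -> nat).
Hypothesis B : blocks z a b P S y e.
Hypothesis y0 : y 0 = true.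
Hypothesis Yb : balanced y.

(* The new blocks are fg and g if f and g are the blocks coded by [true] and [false]. *)
Lemma move_isolated_true : (forall k, y k -> y k.+1 = false) ->
  exists y' e', [/\ blocks z (a + b) b P (S + b) y' e', y' 0 = true & balanced y'].
Proof.
move=> iso.
pose s := fix s j := if j is j'.+1 then s j' + (if y (s j') then 2 else 1) else 0.
pose y' j := y (s j).
have s0 : s 0 = 0 by [].
have sS j : s j.+1 = s j + (if y' j then 2 else 1) by [].
clearbody s.
(* Every new boundary except the origin is preceded by a block g, which adds [b] letters to the
   common left extension. *)
have prev j : s j.+1 = (s j.+1).-1.+1 /\ y (s j.+1).-1 = false.
  rewrite sS; case E: (y' j); rewrite ?addn2 ?addn1 //=.
  by split=> //; apply: iso.
(* The new code cuts [y] itself into blocks, so [blocks_agree] also carries agreements of [y'] over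
   to [y]. *)
have By : blocks y 2 1 0 0 y' s.
  split=> // k k' ekk'.
  move=> t tl; have [->|t1] : t = 0 \/ t = 1 by case: (y' k) tl; lia.
    by rewrite !addn0.
  move: tl; rewrite t1 !addn1; case E: (y' k) => // _.
  by rewrite !iso // -/(y' _) -?ekk' E.
exists y', (e \o s); split; rewrite /y' ?s0 //; rewrite -/y'.
- have step j : e (s j.+1) = e (s j) + (if y' j then a + b else b).
    rewrite sS /y'; case E: (y (s j)); rewrite ?addn2 ?addn1 !(bl_step B) E //.
    by rewrite iso // addnA.
  split=> //=.
  + by rewrite s0 (bl_start B).
  + move=> k k' ekk'.
    have [|_] := blocks_agree (k := s k) (k' := s k') (n := if y' k then 2 else 1) B.
      exact: (bl_eq By).
    by rewrite -sS step addKn; apply: agree_le; lia.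
  + by move=> k k'; apply: (bl_right B).
  + move=> [|k] [|k'] t /=; rewrite ?s0 ?(bl_start B); try by move=> *; lia.
    have [+ p1] := prev k; set m := (s k.+1).-1; move=> ->.
    have [+ p2] := prev k'; set m' := (s k'.+1).-1; move=> ->.
    rewrite !(bl_step B) p1 p2 => tS tk tk'.
    case: (ltnP t b) => tb.
      have := bl_eq B (k := m) (k' := m'); rewrite p1 p2 => /(_ erefl).
      by move=> /(_ (b - t.+1)) h; rewrite -!addnBA //; apply: h; lia.
    have := bl_left B (k := m) (k' := m') (t := t - b).
    have -> : e m + b - t.+1 = e m - (t - b).+1 by lia.
    have -> : e m' + b - t.+1 = e m' - (t - b).+1 by lia.
    by apply; lia.
(* A word s violating balance for [y'] yields one for [y]: g followed by the decoding of s. It is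
   preceded by f within a block fg, and by the g ending the previous block before a lone g; that
   previous block exists because [y 0] is true. *)
- move=> n i j i' j' hi hj hi' hj' A1 A2 A3 ei ej ei' ej'.
  have [l1 B1] := blocks_agree By A1.
  have [l2 B2] := blocks_agree By A2.
  have [l3 B3] := blocks_agree By A3.
  have m0 := blocks_mono By i.+1 n.
  rewrite !addn0 in B1 B2 B3.
  have [L eL] : {L | s (i.+1 + n) - s i.+1 = L} by exists (s (i.+1 + n) - s i.+1).
  rewrite eL in B1 B2 B3.
  have nz k : y' k = false -> s k = (s k).-1.+1 /\ y (s k).-1 = false.
    case: k => [|k] h; last exact: prev.
    by move: h; rewrite /y' s0 y0.
  have [q1 r1] := nz _ hi'; have [q2 r2] := nz _ hj'.
  have st k : y' k = true -> s k.+1 = (s k).+2 by move=> h; rewrite sS h addn2.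
  have sf k : y' k = false -> s k.+1 = (s k).+1 by move=> h; rewrite sS h addn1.
  have ti := st _ hi; have tj := st _ hj; have fi := sf _ hi'; have fj := sf _ hj'.
  have sh u v : y u.+1 = y v.+1 -> agree y u.+2 v.+2 L -> agree y u.+1 v.+1 L.+1.
    move=> h A; rewrite -(add1n L); apply: agree_cat; rewrite ?addn1 //.
    by move=> [|//] _; rewrite !addn0.
  have yi : y (s i).+1 = false by apply: iso.
  have yj : y (s j).+1 = false by apply: iso.
  have E1 : (s i).+1 + L.+1 = s (i.+1 + n) by clear -ti eL m0; lia.
  have E2 : (s j).+1 + L.+1 = s (j.+1 + n) by clear -ti tj eL m0 l1; lia.
  have E3 : s i' + L.+1 = s (i'.+1 + n) by clear -ti fi eL m0 l2; lia.
  have E4 : s j' + L.+1 = s (j'.+1 + n) by clear -ti fj eL m0 l3; lia.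
  apply: (Yb (n := L.+1) (i := s i) (j := s j) (i' := (s i').-1) (j' := (s j').-1)) => //.
  + apply: sh; first by rewrite yi yj.
    by rewrite -ti -tj; exact: B1.
  + apply: sh; first by rewrite -q1 yi -/(y' _) hi'.
    by rewrite -ti -q1 -fi; exact: B2.
  + apply: sh; first by rewrite -q2 yi -/(y' _) hj'.
    by rewrite -ti -q2 -fj; exact: B3.
  + by rewrite E1.
  + by rewrite E2.
  + by rewrite -q1 E3.
  + by rewrite -q2 E4.
Qed.

(* The new blocks are f and fg.  When fg comes first it is still coded by [false], and the
   two letters remain to be exchanged. *)
Lemma move_isolated_false : (forall k, y k = false -> y k.+1) ->
  exists y' e', [/\ blocks z a (a + b) (P + a) S y' e', y' 0 = y 1 & balanced y'].
Proof.
move=> iso.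
pose s := fix s j := if j is j'.+1 then s j' + (if y (s j').+1 then 1 else 2) else 0.
pose y' j := y (s j).+1.
have s0 : s 0 = 0 by [].
have sS j : s j.+1 = s j + (if y' j then 1 else 2) by [].
clearbody s.
have ys j : y (s j) = true.
  elim: j => [|j IH]; rewrite ?s0 // sS /y'.
  by case E: (y (s j).+1); rewrite ?addn1 ?addn2 // iso.
have By : blocks y 1 2 1 0 y' s.
  split=> //.
  - move=> k k' ekk' t tl; have [->|t1] : t = 0 \/ t = 1 by case: (y' k) tl; lia.
      by rewrite !addn0 !ys.
    by rewrite t1 !addn1.
  - by move=> k k' [|//] _; rewrite !addn0 !ys.
have step j : e (s j.+1) = e (s j) + (if y' j then a else a + b).
  rewrite sS; case E: (y' j); rewrite ?addn2 ?addn1 !(bl_step B) ys //.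
  by rewrite -/(y' _) E addnA.
exists y', (e \o s); split; rewrite /y' ?s0 //; rewrite -/y'.
- split=> //=.
  + by rewrite s0 (bl_start B).
  + move=> k k' ekk'.
    have [|_] := blocks_agree (k := s k) (k' := s k') (n := if y' k then 1 else 2) B.
      exact: (bl_eq By).
    by rewrite -sS step addKn; apply: agree_le; lia.
  (* All new blocks begin with f, so the common right extension gains [a]. *)
  + move=> k k'.
    have [|_] := blocks_agree (k := s k) (k' := s k') (n := 1) B.
      by move=> [|//] _; rewrite !addn0 !ys.
    by rewrite !addn1 (bl_step B) ys addKn addnC.
  + by move=> k k'; apply: (bl_left B).
(* Here the violating word for [y] is the decoding of s followed by the initial f of the next block;
   the letter after that f tells f from fg. *)
- move=> n i j i' j' hi hj hi' hj' A1 A2 A3 ei ej ei' ej'.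
  have [l1 B1] := blocks_agree By A1.
  have [l2 B2] := blocks_agree By A2.
  have [l3 B3] := blocks_agree By A3.
  have m0 := blocks_mono By i.+1 n.
  rewrite !addn1 in B1 B2 B3.
  have [L eL] : {L | s (i.+1 + n) - s i.+1 = L} by exists (s (i.+1 + n) - s i.+1).
  rewrite eL in B1 B2 B3.
  have st k : y' k = true -> s k.+1 = (s k).+1 by move=> h; rewrite sS h addn1.
  have sf k : y' k = false -> s k.+1 = (s k).+2 by move=> h; rewrite sS h addn2.
  have ti := st _ hi; have tj := st _ hj; have fi := sf _ hi'; have fj := sf _ hj'.
  have E1 : (s i).+1 + L.+1 = (s (i.+1 + n)).+1 by clear -ti eL m0; lia.
  have E2 : (s j).+1 + L.+1 = (s (j.+1 + n)).+1 by clear -ti tj eL m0 l1; lia.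
  have E3 : (s i').+2 + L.+1 = (s (i'.+1 + n)).+1 by clear -ti fi eL m0 l2; lia.
  have E4 : (s j').+2 + L.+1 = (s (j'.+1 + n)).+1 by clear -ti fj eL m0 l3; lia.
  apply: (Yb (n := L.+1) (i := s i) (j := s j) (i' := (s i').+1) (j' := (s j').+1)) => //.
  + by rewrite -ti -tj; exact: B1.
  + by rewrite -ti -fi; exact: B2.
  + by rewrite -ti -fj; exact: B3.
  + by rewrite E1.
  + by rewrite E2.
  + by rewrite E3.
  + by rewrite E4.
Qed.

End Moves.

(** * Iterating the renormalisation *)

Definition aperiodic (T : Type) (z : nat -> T) :=
  forall N d, 0 < d -> exists2 l, N <= l & z l <> z (l + d).

Definition repeats (T : Type) (z : nat -> T) (J N : nat) :=
  exists i d, [/\ 0 < d, i + d = J & agree z i (i + d) N].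

(* Here [C] is the constant value of a + b - P - S. *)
Definition level (T : Type) (z : nat -> T) (C a b P : nat) :=
  [/\ 0 < a, 0 < b & exists S y e,
    [/\ blocks z a b P S y e, P + S + C = a + b, y 0 = true & balanced y]].

Section Level.
Variables (T : Type) (z : nat -> T).
Hypothesis z_aper : aperiodic z.

(** If all late code letters were equal, [z] would be eventually periodic with period [a] or [b]. *)
Lemma aperiodic_code a b P S y e N (c : bool) :
  0 < a -> 0 < b -> blocks z a b P S y e -> exists2 k, N <= k & y k = c.
Proof.
move=> a0 b0 B; apply: contrapT => H.
have yc k : N <= k -> y k = ~~ c.
  move=> Nk; case E: (y k == c); last by case: (y k) E; case: (c).
  by case: H; exists k => //; apply/eqP.
have := z_aper (e N) (d := if ~~ c then a else b); case=> [|l Nl]; first by case: (c).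
have ge k n : n <= e (k + n) - e k.
  elim: n => [|n IH] //; rewrite addnS (bl_step B).
  by have := blocks_mono B k n; case: (y _); lia.
have [|_] := blocks_agree (k := N) (k' := N.+1) (n := (l - e N).+1) B.
  by move=> t _; rewrite !yc; lia.
move=> /(_ (l - e N)) A; case.
have -> : l = e N + (l - e N) by lia.
rewrite A; last by have := ge N (l - e N).+1; lia.
by rewrite (bl_step B) yc //; congr z; lia.
Qed.

Lemma code_switch (y : nat -> bool) (c : bool) :
  (forall N c', exists2 k, N <= k & y k = c') -> exists2 k, y k = c & y k.+1 = ~~ c.
Proof.
move=> H; apply: contrapT => H1.
have [k _ yk] := H 0 c; have [l kl yl] := H k (~~ c).
suff h n : y (k + n) = c.
  by move: yl; rewrite -(subnKC kl) h; case: (c).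
elim: n => [|n IH]; first by rewrite addn0.
rewrite addnS; case E: (y (k + n).+1 == c); first exact/eqP.
by case: H1; exists (k + n) => //; case: (y (k + n).+1) E; case: (c).
Qed.

(** If both 11 and 00 occurred, they would violate balance at the empty word, together with the
    switches 10 and 01 that aperiodicity provides. *)
Lemma code_isolated a b P S y e : 0 < a -> 0 < b -> blocks z a b P S y e ->
  balanced y ->
  (forall k, y k -> y k.+1 = false) \/ (forall k, y k = false -> y k.+1).
Proof.
move=> a0 b0 B Yb; apply: contrapT => /not_orP [].
move=> /existsNP [k /not_implyP [k1 k2]] /existsNP [l /not_implyP [l1 l2]].
have inf N c := aperiodic_code N c a0 b0 B.
have [p p1 p2] := code_switch true inf.
have [q q1 q2] := code_switch false inf.
apply: (Yb 0 k p q l); rewrite ?addn0 //.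
- by move: k2; case: (y k.+1) => // /(_ erefl).
- by move: l2; case: (y l.+1) => // /(_ erefl).
Qed.

Lemma level_front a b P C : level z C a b P -> repeats z a P.
Proof.
move=> [a0 b0 [S] [y] [e] [B _ y0 _]]; exists 0, a; split=> //.
have := bl_right B 0 1.
by rewrite (bl_step B) (bl_start B) y0.
Qed.

(* The first two boundaries after the origin agree on [P] letters to the right and on
   [minn a S] letters to the left. *)
Lemma blocks_inner a b P S C y e : 0 < b -> blocks z a b P S y e ->
  P + S + C = a + b -> y 0 = true -> y 1 = false ->
  repeats z b (a + P) \/ exists2 N, repeats z (P + C) N & N + C = a + b.
Proof.
move=> b0 B PS y0 y1.
have e1 : e 1 = a by rewrite (bl_step B) (bl_start B) y0.
have e2 : e 2 = a + b by rewrite (bl_step B) y1 e1.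
have right : agree z a (a + b) P by have := bl_right B 1 2; rewrite e1 e2.
have left m : m <= S -> m <= a -> agree z (a - m) (a + b - m) m.
  move=> mS ma t tm.
  have := bl_left B (k := 1) (k' := 2) (t := m - t.+1).
  rewrite e1 e2.
  have -> : a - (m - t.+1).+1 = a - m + t by lia.
  have -> : a + b - (m - t.+1).+1 = a + b - m + t by lia.
  by apply; lia.
case: (leqP a S) => aS.
  left; exists 0, b; split=> //.
  apply: (@agree_cast _ z (a - a) (a + b - a) (a + P)); try lia.
  by apply: agree_cat; [exact: left | apply: (agree_cast right); lia].
(* Here J = a - S + b is [P + C], and N = S + P falls short of a + b by [C]. *)
right; exists (S + P); last by lia.
exists (a - S), b; split; [lia | lia |].
apply: (@agree_cast _ z (a - S) (a + b - S) (S + P)); try lia.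
by apply: agree_cat; [apply: left; lia | apply: (agree_cast right); lia].
Qed.

Definition inner_repeat C a b P :=
  repeats z b (a + P) \/ exists2 N, repeats z (P + C) N & N + C = a + b.

(** The cases are the moves X, Y and Z. Y and Z both come from an isolated g and differ in the value
    of [y 1]; X and Z have [y 1] false, which gives the inner repetition. *)
Lemma level_step C a b P : level z C a b P -> exists a' b' P', level z C a' b' P' /\
  [\/ [/\ a' = a + b, b' = b, P' = P & inner_repeat C a b P],
      [/\ a' = a, b' = a + b & P' = P + a] |
      [/\ a' = a + b, b' = a, P' = P + a & inner_repeat C a b P]].
Proof.
move=> [a0 b0 [S] [y] [e] [B PS y0 Yb]].
case: (code_isolated a0 b0 B Yb) => iso.
  have [y' [e' [B' y0' Yb']]] := move_isolated_true B y0 Yb iso.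
  exists (a + b), b, P; split.
    by split; [lia | lia | exists (S + b), y', e'; split=> //; lia].
  by apply: Or31; split=> //; apply: (blocks_inner b0 B) => //; apply: iso.
have [y' [e' [B' y0' Yb']]] := move_isolated_false B y0 Yb iso.
case E: (y 1); rewrite E in y0'.
  exists a, (a + b), (P + a); split; last by apply: Or32.
  by split; [lia | lia | exists S, y', e'; split=> //; lia].
exists (a + b), a, (P + a); split.
  split; [lia | lia | exists S, (fun k => ~~ y' k), e'; split; [|lia| |]].
  - exact: blocks_swap.
  - by rewrite y0'.
  - exact: balanced_swap.
by apply: Or33; split=> //; apply: (blocks_inner b0 B).
Qed.

End Level.

(** * Right special factors, at most one of each length and with only two right extensions, and
    their return words *)

Definition special_unique (T : Type) (x : nat -> T) (n : nat) := forall i j i' j',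
  agree x i j n -> x (i + n) <> x (j + n) ->
  agree x i' j' n -> x (i' + n) <> x (j' + n) ->
  agree x i i' n /\ (x (i' + n) = x (i + n) \/ x (i' + n) = x (j + n)).

Lemma repeated_window (T : finType) (x : nat -> T) N n :
  exists i j, [/\ N <= i, i < j & agree x i j n].
Proof.
pose f (k : 'I_(#|{: n.-tuple T}|.+1)) := [tuple x (N + k + t) | t < n].
have : ~ injective f.
  by move=> /leq_card; rewrite card_ord ltnn.
move=> /injectiveP /injectivePn [k [k' kk' fk]].
have A : agree x (N + k) (N + k') n.
  move=> t tn; move: fk => /(congr1 (fun w => tnth w (Ordinal tn))).
  by rewrite !tnth_mktuple.
have ne : (k : nat) != k' by apply: contra kk' => /eqP /val_inj ->.
case: (ltnP k k') => h.
  by exists (N + k), (N + k'); split=> //; lia.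
by exists (N + k'), (N + k); split; [lia | lia | exact: agree_sym].
Qed.

(** Otherwise each late window of length [n] would determine the next letter, and a repeated window
    would force a period. *)
Lemma aperiodic_special (T : finType) (x : nat -> T) N n : aperiodic x ->
  exists i j, [/\ N <= i, N <= j, agree x i j n & x (i + n) <> x (j + n)].
Proof.
move=> xa; apply: contrapT => H.
have [i [j [Ni ij A]]] := repeated_window x N n.
have det m : agree x i j (n + m).
  elim: m => [|m IH]; first by rewrite addn0.
  rewrite addnS -addn1; apply: agree_cat => // -[|//] _; rewrite !addn0.
  apply: contrapT => ne; apply: H; exists (i + m), (j + m).
  split; [lia | lia | by apply: agree_shift; rewrite addnC |].
  by rewrite -!addnA (addnC m).
have [|l il] := xa i (j - i); first by lia.
case; have -> : l = i + (l - i) by lia.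
by rewrite (det (l - i).+1) ?leq_addl //; congr x; lia.
Qed.

(* The blocks of the first stage are the return words to the right special word of
   length [n0] that occurs at [i0] and [j0]. *)
Section Return.
Variables (T : finType) (x : nat -> T) (n0 i0 j0 : nat).
Hypothesis xa : aperiodic x.
Hypothesis spec : forall n, n0 <= n -> special_unique x n.
Hypothesis A0 : agree x i0 j0 n0.
Hypothesis N0 : x (i0 + n0) <> x (j0 + n0).

Let occ i := agree x i i0 n0.

Let letter i : occ i -> x (i + n0) = x (i0 + n0) \/ x (i + n0) = x (j0 + n0).
Proof.
move=> oi; case: (eqVneq (x (i + n0)) (x (i0 + n0))) => [|/eqP ne]; first by left.
by have [_] := spec (leqnn n0) A0 N0 oi ne.
Qed.

Let special_occ i j : agree x i j n0 -> x (i + n0) <> x (j + n0) -> occ i.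
Proof. by move=> A N; have [/agree_sym] := spec (leqnn n0) A0 N0 A N. Qed.

(** Right special words occur arbitrarily late, and by uniqueness they are all the word at [i0]. *)
Let next_ex i : exists i', [/\ i < i', occ i' & forall t, i < t -> t < i' -> ~ occ t].
Proof.
have [j [k [ij _ A N]]] := aperiodic_special i.+1 n0 xa.
have ex : exists j, (i < j) && `[< occ j >].
  by exists j; rewrite ij; apply/asboolP; exact: (special_occ A N).
case: (ex_minnP ex) => m /andP [im /asboolP om] mmin.
exists m; split=> // t it tm ot; have : m <= t by apply: mmin; rewrite it; apply/asboolP.
by lia.
Qed.

Lemma return_level : exists m C a b, level (fun t => x (m + t)) C a b 0.
Proof.
have [next nextP] := choice next_ex.
have next_gt i : i < next i by case: (nextP i).
have next_occ i : occ (next i) by case: (nextP i).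
have next_min i t : i < t -> t < next i -> ~ occ t by case: (nextP i) => _ _; apply.
(* Up to the next occurrence no other right special position is met, so the letter after an
   occurrence determines the whole return word. *)
have agr i j : occ i -> occ j -> x (i + n0) = x (j + n0) ->
    agree x i j (n0 + (next i - i)).
  move=> oi oj e0.
  have H t : t <= next i - i -> agree x i j (n0 + t).
    elim: t => [|t IH] tl.
      by rewrite addn0; apply: (agree_trans oi); apply: agree_sym.
    have At := IH (ltnW tl); rewrite addnS -addn1.
    apply: agree_cat => // -[|//] _; rewrite !addn0.
    case: t tl {IH} At => [|t] tl At; first by rewrite !addn0.
    case: (eqVneq (x (i + (n0 + t.+1))) (x (j + (n0 + t.+1)))) => // /eqP ne.
    case: (next_min i (i + t.+1)); [lia | have := next_gt i; lia |].
    apply: (@special_occ _ (j + t.+1)).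
      by apply: agree_shift; rewrite addnC.
    by rewrite -!addnA (addnC _ n0).
  exact: H.
have ret_le i j : occ i -> occ j -> x (i + n0) = x (j + n0) ->
    next j - j <= next i - i.
  move=> oi oj e0; have A := agr _ _ oi oj e0.
  have oj' : occ (j + (next i - i)).
    apply: agree_trans (next_occ i); apply: agree_sym.
    have {1}-> : next i = i + (next i - i) by have := next_gt i; lia.
    by apply: agree_shift; rewrite addnC.
  have := next_gt i; have := next_gt j; move=> h1 h2.
  rewrite leqNgt; apply/negP => lt; apply: (next_min j _ _ _ oj'); lia.
have ret i j : occ i -> occ j -> x (i + n0) = x (j + n0) ->
    next j - j = next i - i.
  by move=> oi oj e0; apply/eqP; rewrite eqn_leq !ret_le.
have occ_i0 : occ i0 by [].
have occ_j0 : occ j0 by apply: agree_sym.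
pose a := next i0 - i0; pose b := next j0 - j0.
have a_gt0 : 0 < a by rewrite /a; have := next_gt i0; lia.
have b_gt0 : 0 < b by rewrite /b; have := next_gt j0; lia.
pose o k := iter k next i0.
have oo k : occ (o k) by case: k => [|k]; [exact: occ_i0 | exact: next_occ].
have oS k : o k.+1 = next (o k) by [].
have oge k : i0 <= o k.
  by elim: k => // k IH; rewrite oS; have := next_gt (o k); lia.
pose y k := x (o k + n0) == x (i0 + n0).
have yT k : y k = true -> x (o k + n0) = x (i0 + n0) by move=> /eqP.
have yF k : y k = false -> x (o k + n0) = x (j0 + n0).
  by move=> /eqP; case: (letter (oo k)).
have len k : next (o k) - o k = if y k then a else b.
  by case E: (y k); apply: ret => //; [rewrite yT | rewrite yF].
(* Boundaries are placed just after each occurrence, so that a block starts with the letter which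
   [y] encodes; with P = S = 0 the constant is [a + b]. *)
exists (i0 + n0), (a + b), a, b; split=> //.
pose e k := o k - i0.
have eo k : i0 + n0 + e k = o k + n0 by rewrite /e; have := oge k; lia.
have estep k : e k.+1 = e k + (if y k then a else b).
  by rewrite /e oS -len; have := oge k; have := next_gt (o k); lia.
have eeq k k' : y k = y k' ->
    agree x (o k) (o k') (n0 + (if y k then a else b)).
  move=> ykk'; rewrite -len; apply: agr => //.
  by case E: (y k); [rewrite !yT -?ykk' | rewrite !yF -?ykk'].
exists 0, y, e; split=> //.
- split=> //; first by rewrite /e subnn.
  move=> k k' ykk' t tl; rewrite !addnA !eo -!addnA; apply: (eeq _ _ ykk'); lia.
- by rewrite /y eqxx.
- have Bx : blocks (fun t => x (i0 + n0 + t)) a b 0 0 y e.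
    split=> //; first by rewrite /e subnn.
    move=> k k' ykk' t tl; rewrite !addnA !eo -!addnA; apply: (eeq _ _ ykk'); lia.
  have xe k : x (o k + n0) = if y k then x (i0 + n0) else x (j0 + n0).
    by case E: (y k); [apply: yT | apply: yF].
  (* The words at [o p] and [o r] are right special. The suffix of the longer one with the length of
     the shorter one is right special too, hence equal to it. If [c < d], this puts an occurrence
     strictly inside a return word; if [c = d], the letters encoding [o p] and [o r] coincide. *)
  have cross p q r s c d L : c <= d -> 0 < c -> next (o r) = o r + d ->
      agree x (o p) (o q) (n0 + (c + L)) ->
      x (o p + (n0 + (c + L))) <> x (o q + (n0 + (c + L))) ->
      agree x (o r) (o s) (n0 + (d + L)) ->
      x (o r + (n0 + (d + L))) <> x (o s + (n0 + (d + L))) ->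
      x (o p + n0) <> x (o r + n0) -> False.
    move=> cd c0 nr Apq Npq Ars Nrs; case.
    have E u : o u + (d - c) + (n0 + (c + L)) = o u + (n0 + (d + L)) by lia.
    have [||A _] := @spec (n0 + (c + L)) (leq_addr _ _) (o p) (o q) (o r + (d - c)) (o s + (d - c)) Apq Npq.
    - by apply: agree_shift; apply: (agree_cast Ars); lia.
    - by rewrite !E.
    case: (ltngtP c d) cd => // [lt | eq] _.
      case: (next_min (o r) (o r + (d - c))); [lia | lia |].
      apply: agree_trans (oo p); apply: agree_sym.
      by apply: agree_le A; lia.
    by rewrite A ?eq ?subnn ?addn0 //; lia.
  move=> n i j i' j' hi hj hi' hj' A1 A2 A3 ei ej ei' ej'.
  have oe k : o k = i0 + e k by rewrite /e; have := oge k; lia.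
  have ext k k' : y k = y k' -> agree y k.+1 k'.+1 n -> agree y k k' n.+1.
    move=> h A; rewrite -add1n; apply: agree_cat; rewrite ?addn1 //.
    by move=> [|//] _; rewrite !addn0.
  have full k k' (c L : nat) : y k = y k' -> (if y k then a else b) = c ->
      e (k.+1 + n) = e k.+1 + L -> agree y k.+1 k'.+1 n ->
      agree x (o k) (o k') (n0 + (c + L)).
    move=> h hc hL A; have [_ A'] := blocks_agree Bx (ext _ _ h A).
    apply: agree_cat; first by apply: (agree_trans (oo k)); apply: agree_sym; exact: oo.
    move=> t tl; rewrite -!eo; have := A' t; rewrite /= !addnA; apply.
    by rewrite addn0 addnS -addSn hL estep hc; lia.
  have [l1 _] := blocks_agree Bx A1.
  have [l2 _] := blocks_agree Bx A2.
  have [l3 _] := blocks_agree Bx A3.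
  have [L hL] : {L | e (i.+1 + n) = e i.+1 + L}.
    by exists (e (i.+1 + n) - e i.+1); rewrite subnKC // (blocks_mono Bx).
  have hj2 : e (j.+1 + n) = e j.+1 + L by lia.
  have hi2 : e (i'.+1 + n) = e i'.+1 + L by lia.
  have hj3 : e (j'.+1 + n) = e j'.+1 + L by lia.
  have pos k c : (if y k then a else b) = c -> e (k.+1 + n) = e k.+1 + L ->
      o k + (n0 + (c + L)) = o (k.+1 + n) + n0.
    by move=> hc h; rewrite !oe h estep hc; lia.
  have F1 : agree x (o i) (o j) (n0 + (a + L)) by apply: full; rewrite ?hi ?hj.
  have F2 : agree x (o i') (o j') (n0 + (b + L)).
    by apply: full; rewrite ?hi' ?hj' //; apply: (agree_trans (agree_sym A2)).
  have D1 : x (o i + (n0 + (a + L))) <> x (o j + (n0 + (a + L))).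
    by rewrite !pos ?hi ?hj // (yT _ ei) (yF _ ej).
  have D2 : x (o i' + (n0 + (b + L))) <> x (o j' + (n0 + (b + L))).
    by rewrite !pos ?hi' ?hj' // (yT _ ei') (yF _ ej').
  case: (leqP a b) => ab.
    apply: (cross i j i' j' a b L) => //; last by rewrite (yT _ hi) (yF _ hi').
    by have := len i'; rewrite hi'; have := next_gt (o i'); lia.
  apply: (cross i' j' i j b a L) => //; first exact: ltnW.
    by have := len i; rewrite hi; have := next_gt (o i); lia.
  by rewrite (yT _ hi) (yF _ hi') => /esym.
Qed.
End Return.

(** * Factor complexity *)

(** Otherwise [x1] and [y1] could both be removed from [A] without changing its image, which would
    have at least two elements fewer than [A]. *)
Lemma imset_collision (aT rT : finType) (f : aT -> rT) (A : {set aT}) x1 x2 y1 y2 :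
  #|A| <= #|f @: A|.+1 -> x1 \in A -> x2 \in A -> y1 \in A -> y2 \in A ->
  x1 != x2 -> f x1 = f x2 -> y1 != y2 -> f y1 = f y2 -> y1 = x1 \/ y1 = x2.
Proof.
move=> cA Ax1 Ax2 Ay1 Ay2 nx fx ny fy.
have [->|n1] := eqVneq y1 x1; first by left.
have [->|n2] := eqVneq y1 x2; first by right.
have Bx2 : x2 \in A :\ x1 :\ y1 by rewrite !inE Ax2 eq_sym n2 eq_sym nx.
have : f @: A \subset f @: (A :\ x1 :\ y1).
  apply/fintype.subsetP => _ /imsetP [w Aw ->].
  have [->|w1] := eqVneq w x1; first by rewrite fx imset_f.
  have [->|w2] := eqVneq w y1; last by apply: imset_f; rewrite !inE Aw w1 w2.
  have [e|w3] := eqVneq y2 x1; first by rewrite fy e fx imset_f.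
  by rewrite fy imset_f // !inE Ay2 w3 eq_sym ny.
move=> /subset_leq_card /leq_trans /(_ (leq_imset_card _ _)).
have := cardsD1 x1 A; have := cardsD1 y1 (A :\ x1).
by rewrite !inE Ay1 n1 Ax1 /=; lia.
Qed.

Section Words.
Variables (T : finType) (x : nat -> T).

Definition word n l : n.-tuple T := [tuple x (l + t) | t < n].
Definition words n : {set n.-tuple T} := [set w | `[< exists l, w = word n l >]].

Lemma word_agree n i j : word n i = word n j <-> agree x i j n.
Proof.
split=> [e t tn | h].
  by have := congr1 (fun w => tnth w (Ordinal tn)) e; rewrite !tnth_mktuple.
by apply: eq_from_tnth => t; rewrite !tnth_mktuple; apply: h.
Qed.

Lemma mem_words n l : word n l \in words n.
Proof. by rewrite inE; apply/asboolP; exists l. Qed.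

Lemma wordsP n w : w \in words n -> exists l, w = word n l.
Proof. by rewrite inE => /asboolP. Qed.

Definition chop n (w : n.+1.-tuple T) : n.-tuple T := [tuple tnth w (widen_ord (leqnSn n) t) | t < n].

Lemma chop_word n l : chop (word n.+1 l) = word n l.
Proof. by apply: eq_from_tnth => t; rewrite !tnth_mktuple. Qed.

Lemma words_chop n : words n = @chop n @: words n.+1.
Proof.
apply/setP => w; apply/idP/imsetP => [/wordsP [l ->] | [w' /wordsP [l ->] ->]].
  by exists (word n.+1 l); rewrite ?chop_word ?mem_words.
by rewrite chop_word mem_words.
Qed.

Lemma card_words0 : #|words 0| = 1.
Proof.
apply/eqP; rewrite eqn_leq (leq_trans (max_card _)) ?card_tuple ?expn0 //=.
by apply/card_gt0P; exists (word 0 0); apply: mem_words.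
Qed.

(** A right special word has two preimages under [chop]. *)
Lemma card_words_ltS n : aperiodic x -> #|words n| < #|words n.+1|.
Proof.
move=> xa; rewrite ltn_neqAle (words_chop n) leq_imset_card andbT; apply/negP => /imset_injP inj.
have [i [j [_ _ A N]]] := aperiodic_special 0 n xa.
have /word_agree /(_ n (ltnSn n)) // : word n.+1 i = word n.+1 j.
by apply: inj; rewrite ?mem_words // !chop_word; apply/word_agree.
Qed.

(** Under the bound on cardinals [chop] identifies at most one pair, and each right special word is
    the image of such a pair. *)
Lemma special_unique_words n : #|words n.+1| <= #|words n|.+1 -> special_unique x n.
Proof.
rewrite (words_chop n) => cw i j i' j' A N A' N'.
have ne u v : x (u + n) <> x (v + n) -> word n.+1 u != word n.+1 v.
  by move=> nuv; apply/eqP => /word_agree /(_ n (ltnSn n)).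
have ch u v : agree x u v n -> chop (word n.+1 u) = chop (word n.+1 v).
  by move=> h; rewrite !chop_word; apply/word_agree.
case: (imset_collision cw (mem_words _ i) (mem_words _ j) (mem_words _ i') (mem_words _ j')
  (ne _ _ N) (ch _ _ A) (ne _ _ N') (ch _ _ A')) => /word_agree B.
  split; first by apply: agree_sym; apply: agree_le B.
  by left; apply: B.
split; last by right; apply: B.
by apply: (agree_trans A); apply: agree_sym; apply: agree_le B.
Qed.

(** The difference between the number of words and their length is nondecreasing; bounded along a
    subsequence, it is eventually constant. *)
Lemma special_unique_eventually K : aperiodic x ->
  (forall m, exists2 n, m <= n & #|words n| <= n + K) ->
  exists n0, forall n, n0 <= n -> special_unique x n.
Proof.
move=> xa hK.
have lt n := card_words_ltS n xa.
have mono n d : #|words n| + d <= #|words (n + d)|.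
  by elim: d => [|d IH]; rewrite ?addn0 // !addnS; have := lt (n + d); lia.
have bound n : n <= #|words n| <= n + K.
  have [m nm hm] := hK n; have := mono n (m - n); rewrite subnKC //.
  by have := mono 0 n; rewrite add0n card_words0; lia.
have [n0 hn0] : exists n0, forall n, n0 <= n -> #|words n| + n0 <= #|words n0| + n.
  have : exists k, `[< exists n, k + n <= #|words n| >] by exists 0; apply/asboolP; exists 0.
  case/(ex_maxnP (m := K)) => [k /asboolP [n hn] | k /asboolP [n0 h0] kmax].
    by have := bound n; lia.
  exists n0 => n n0n; have := bound n; rewrite leqNgt => bn; apply/negP => c.
  have : #|words n| - n <= k by apply: kmax; apply/asboolP; exists n; lia.
  by lia.
exists n0 => n n0n; apply: special_unique_words.
have := hn0 n.+1; have := hn0 n n0n; have := mono n0 (n - n0).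
by rewrite subnKC //; lia.
Qed.

End Words.

(** * Tight sequences of moves are eventually periodic *)

Inductive move := MX | MY | MZ.

Definition moved (m : move) (a b p a' b' p' : nat) := match m with
  | MX => [/\ a' = a + b, b' = b & p' = p]
  | MY => [/\ a' = a, b' = a + b & p' = p + a]
  | MZ => [/\ a' = a + b, b' = a & p' = p + a]
  end.

(* 151/100 lies slightly above 2/3 + 4/15 sqrt 10 = 1.5099..., the value to be reached. *)
Definition tight (m : move) (a b p : nat) :=
  [/\ 0 < a, 0 < b, 100 * p <= 151 * a &
    (m <> MY -> 100 * (a + p) <= 151 * b \/ 100 * (a + b) <= 151 * p)].

(* Each case split on a move is pruned at once, keeping the tree of live words small. *)
Ltac split_move m hm ht := let c := fresh in
  case: m hm ht => -[? ? ?] [? ? ? ht]; subst;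
  (try have {ht} [c|c] := ht ltac:(discriminate)); try clear ht; try (exfalso; lia).

Ltac split_move_XZ m n hm ht := let c := fresh in
  case: m n hm ht => n -[? ? ?] [? ? ? ht]; subst; try (by case: n);
  have {ht} [c|c] := ht ltac:(discriminate); try (exfalso; lia).

Section Tight.
Variables (m : nat -> move) (a b p : nat -> nat).
Hypothesis hm : forall k, moved (m k) (a k) (b k) (p k) (a k.+1) (b k.+1) (p k.+1).
Hypothesis ht : forall k, tight (m k) (a k) (b k) (p k).

Ltac states k :=
  move: (hm k) (ht k) (hm k.+1) (ht k.+1) (hm k.+2) (ht k.+2) (hm k.+3) (ht k.+3)
    (hm k.+4) (ht k.+4) (hm k.+4.+1) (ht k.+4.+1) (hm k.+4.+2) (ht k.+4.+2)
    (hm k.+4.+3) (ht k.+4.+3) (ht k.+4.+4);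
  move: (a k) (a k.+1) (a k.+2) (a k.+3) (a k.+4) (a k.+4.+1) (a k.+4.+2)
    (a k.+4.+3) (a k.+4.+4)
    (b k) (b k.+1) (b k.+2) (b k.+3) (b k.+4) (b k.+4.+1) (b k.+4.+2)
    (b k.+4.+3) (b k.+4.+4)
    (p k) (p k.+1) (p k.+2) (p k.+3) (p k.+4) (p k.+4.+1) (p k.+4.+2)
    (p k.+4.+3) (p k.+4.+4);
  move: (m k) (m k.+1) (m k.+2) (m k.+3) (m k.+4) (m k.+4.+1) (m k.+4.+2)
    (m k.+4.+3) (m k.+4.+4).

(* The case analysis runs backwards from the Y, where far fewer words survive. *)
Lemma tight_no_Y k : m (k.+4.+3) <> MY.
Proof.
move=> E; move: E; states k.
move=> m0 m1 m2 m3 m4 m5 m6 m7 m8.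
move=> a0 a1 a2 a3 a4 a5 a6 a7 a8 b0 b1 b2 b3 b4 b5 b6 b7 b8 p0 p1 p2 p3 p4 p5 p6 p7 p8.
move=> h0 t0 h1 t1 h2 t2 h3 t3 h4 t4 h5 t5 h6 t6 h7 t7 [? ? ? _] E; subst m7.
move: h7 t7 => -[? ? ?] [? ? ? _]; subst.
split_move m6 h6 t6.
all: split_move m5 h5 t5.
all: split_move m4 h4 t4.
all: split_move m3 h3 t3.
all: split_move m2 h2 t2.
all: split_move m1 h1 t1.
all: split_move m0 h0 t0.
Qed.

Hypothesis no_Y : forall k, m k <> MY.

(** The search leaves two continuations of an X. The first one propagates to X forever, which is
    excluded later by growth. *)
Lemma tight_after_X k : m k = MX ->
  (m k.+1 = MX /\ m k.+2 = MX) \/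
  [/\ m k.+1 = MZ, m k.+2 = MZ, m k.+3 = MZ & m k.+4 = MX].
Proof.
move: (@no_Y k.+1) (@no_Y k.+2) (@no_Y k.+3) (@no_Y k.+4) (@no_Y k.+4.+1)
  (@no_Y k.+4.+2) (@no_Y k.+4.+3) (@no_Y k.+4.+4).
states k.
move=> m0 m1 m2 m3 m4 m5 m6 m7 m8.
move=> a0 a1 a2 a3 a4 a5 a6 a7 a8 b0 b1 b2 b3 b4 b5 b6 b7 b8 p0 p1 p2 p3 p4 p5 p6 p7 p8.
move=> h0 t0 h1 t1 h2 t2 h3 t3 h4 t4 h5 t5 h6 t6 h7 t7 t8 n1 n2 n3 n4 n5 n6 n7 n8 E; subst m0.
have {t8} [c8 d8 e8 f8] := t8; have {}f8 := f8 n8.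
move: h0 t0 => -[? ? ?] [? ? ? t0]; subst; have {t0} [?|?] := t0 ltac:(discriminate).
all: split_move_XZ m1 n1 h1 t1.
all: split_move_XZ m2 n2 h2 t2.
all: try by left.
all: split_move_XZ m3 n3 h3 t3.
all: split_move_XZ m4 n4 h4 t4.
all: try by right.
all: split_move_XZ m5 n5 h5 t5.
all: split_move_XZ m6 n6 h6 t6.
all: split_move_XZ m7 n7 h7 t7.
Qed.

(** Under Z the pair (a, b) evolves like Fibonacci numbers and p - a - b is constant, so p / a would
    approach the golden ratio, above 151/100. *)
Lemma tight_not_all_Z k :
  ~ [/\ m k = MZ, m k.+1 = MZ, m k.+2 = MZ & m k.+3 = MZ /\ m k.+4 = MZ].
Proof.
move=> [E0 E1 E2 [E3 E4]]; move: E0 E1 E2 E3 E4; states k.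
move=> m0 m1 m2 m3 m4 m5 m6 m7 m8.
move=> a0 a1 a2 a3 a4 a5 a6 a7 a8 b0 b1 b2 b3 b4 b5 b6 b7 b8 p0 p1 p2 p3 p4 p5 p6 p7 p8.
move=> h0 t0 h1 t1 h2 t2 h3 t3 h4 t4 h5 t5 h6 t6 h7 t7 t8 E0 E1 E2 E3 E4; subst.
move: h0 t0 => -[? ? ?] [? ? ? t0]; subst; have {t0} [?|?] := t0 ltac:(discriminate).
all: move: h1 t1 => -[? ? ?] [? ? ? t1]; subst; have {t1} [?|?] := t1 ltac:(discriminate); try lia.
all: move: h2 t2 => -[? ? ?] [? ? ? t2]; subst; have {t2} [?|?] := t2 ltac:(discriminate); try lia.
all: move: h3 t3 => -[? ? ?] [? ? ? t3]; subst; have {t3} [?|?] := t3 ltac:(discriminate); try lia.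
all: move: h4 t4 => -[? ? ?] [? ? ? t4]; subst; have {t4} [?|?] := t4 ltac:(discriminate); try lia.
all: move: t5 => [? ? ? _]; lia.
Qed.

End Tight.

(** * The extremal word *)

Definition phi (c : bool) : seq bool :=
  if c then [:: true; false; false; true; false; true; false; false]
  else [:: true; false; false; true; false].

Definition Phi (w : seq bool) : seq bool := flatten (map phi w).

Definition iterate (k : nat) : seq bool := iter k Phi [:: true].

Lemma Phi_cat u v : Phi (u ++ v) = Phi u ++ Phi v.
Proof. by rewrite /Phi map_cat flatten_cat. Qed.

Lemma size_Phi w : 5 * size w <= size (Phi w).
Proof.
elim: w => // c w IH; rewrite -cat1s Phi_cat !size_cat.
by have := IH; case: c; rewrite /= ; lia.
Qed.

Lemma iterate_prefix k : exists u, iterate k.+1 = iterate k ++ u.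
Proof.
elim: k => [|k [u IH]]; first by exists (behead (phi true)).
by exists (Phi u); rewrite -Phi_cat -IH.
Qed.

Lemma iterate_prefix_add k n : exists u, iterate (k + n) = iterate k ++ u.
Proof.
elim: n => [|n [u IH]]; first by exists [::]; rewrite addn0 cats0.
have [v hv] := iterate_prefix (k + n).
by exists (u ++ v); rewrite addnS hv IH catA.
Qed.

Lemma size_iterate k : k < size (iterate k).
Proof. by elim: k => // k IH; have := size_Phi (iterate k); rewrite [iterate k.+1]/=; lia. Qed.

(** [iterate n] has more than [n] letters and is a prefix of all later iterates, so this reads off
    the fixed point of [phi]. *)
Definition fixword (n : nat) : bool := nth false (iterate n) n.

Lemma fixwordE k n : n < size (iterate k) -> fixword n = nth false (iterate k) n.
Proof.
move=> nk; rewrite /fixword; case: (leqP n k) => h.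
  have [u] := iterate_prefix_add n (k - n); rewrite subnKC // => ->.
  by rewrite nth_cat size_iterate.
have [u] := iterate_prefix_add k (n - k); rewrite subnKC ?(ltnW h) // => ->.
by rewrite nth_cat nk.
Qed.

(** Where the image of the [j]-th letter starts when the fixed point is cut into images under
    [phi]. *)
Definition block_pos (j : nat) : nat := size (Phi (mkseq fixword j)).

Arguments block_pos : simpl never.

Lemma block_pos0 : block_pos 0 = 0. Proof. by []. Qed.

Lemma block_posS j : block_pos j.+1 = block_pos j + (if fixword j then 8 else 5).
Proof.
rewrite /block_pos /mkseq -addn1 iotaD map_cat Phi_cat size_cat /=.
by rewrite /Phi /= cats0; case: (fixword _).
Qed.

Lemma fixword_block j t : t < (if fixword j then 8 else 5) ->
  fixword (block_pos j + t) = nth false (phi (fixword j)) t.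
Proof.
move=> tl.
have e : Phi (mkseq fixword j.+1) = Phi (mkseq fixword j) ++ phi (fixword j).
  by rewrite /mkseq -addn1 iotaD map_cat Phi_cat /= /Phi /= cats0.
have p : iterate j = mkseq fixword j.+1 ++ drop j.+1 (iterate j).
  rewrite -[LHS](cat_take_drop j.+1); congr cat.
  have sz : size (take j.+1 (iterate j)) = j.+1 by rewrite size_takel // size_iterate.
  apply: (@eq_from_nth _ false); rewrite ?size_mkseq // sz => i ij.
  rewrite nth_mkseq // nth_take // (fixwordE (k := j)) //.
  exact: leq_trans ij (size_iterate j).
have q : iterate j.+1 = Phi (mkseq fixword j) ++ phi (fixword j) ++ Phi (drop j.+1 (iterate j)).
  by rewrite catA -e -Phi_cat -p.
have tl' : t < size (phi (fixword j)) by case: (fixword j) tl.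
rewrite (@fixwordE j.+1); last by rewrite q !size_cat -/(block_pos j); lia.
by rewrite q nth_cat -/(block_pos j) ltnNge leq_addr /= addKn nth_cat tl'.
Qed.

Lemma fixword_start j t : t < 5 ->
  fixword (block_pos j + t) = nth false (phi false) t.
Proof.
move=> t5; rewrite fixword_block; last by case: (fixword j); lia.
by case: (fixword j) => //; move: t t5 => [|[|[|[|[|]]]]].
Qed.

(** Both images, continued by any further image, begin with the same ten letters 1001010010. *)
Lemma fixword_long j t : t < 10 ->
  fixword (block_pos j + t) = nth false (phi true ++ [:: true; false]) t.
Proof.
move=> t10; case: (ltnP t 5) => t5.
  by rewrite fixword_start //; move: t t5 {t10} => [|[|[|[|[|]]]]].
case E: (fixword j); last first.
  have -> : block_pos j + t = block_pos j.+1 + (t - 5) by rewrite block_posS E; lia.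
  rewrite fixword_start; last lia.
  by move: t t10 t5 => [|[|[|[|[|[|[|[|[|[|]]]]]]]]]].
case: (ltnP t 8) => t8.
  rewrite fixword_block E //.
  by move: t t10 t5 t8 => [|[|[|[|[|[|[|[|[|[|]]]]]]]]]].
have -> : block_pos j + t = block_pos j.+1 + (t - 8) by rewrite block_posS E; lia.
rewrite fixword_start; last lia.
by move: t t10 t5 t8 => [|[|[|[|[|[|[|[|[|[|]]]]]]]]]].
Qed.

(** The eleventh letter separates the two images, so ten is the exact length of their common
    continuation. *)
Lemma fixword_exact j : fixword (block_pos j + 10) = ~~ fixword j.
Proof.
case E: (fixword j).
  have -> : block_pos j + 10 = block_pos j.+1 + 2 by rewrite block_posS E; lia.
  by rewrite fixword_start.
have -> : block_pos j + 10 = block_pos j.+1 + 5 by rewrite block_posS E; lia.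
by rewrite fixword_long.
Qed.

Lemma fixword_last j : exists2 m, block_pos j.+1 = m.+1 & fixword m = false.
Proof.
exists (block_pos j + (if fixword j then 7 else 4)).
  by rewrite block_posS; case: (fixword j); lia.
by case E: (fixword j); rewrite fixword_block E.
Qed.

(** Serves twice for base 2: digits below [b - 1] recur, and fractional parts stay away from 1. *)
Lemma fixword_no_TT l : fixword l -> fixword l.+1 = false.
Proof.
have [k [kl lk]] : exists k, (block_pos k <= l) /\ (l < block_pos k.+1).
  have ex : exists k, (l < block_pos k).
    exists l.+1; have : (l.+1 <= block_pos l.+1); last by [].
    by elim: l.+1 => // n IH; rewrite block_posS; case: (fixword n); lia.
  case: (ex_minnP ex) => [[|k]] // lk kmin; exists k; split=> //.
  by rewrite leqNgt; apply/negP => /kmin; lia.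
rewrite -(subnKC kl) -addnS; have : (l - block_pos k < 8).
  by move: lk; rewrite block_posS; case: (fixword k); lia.
move: (l - block_pos k) => t t8; rewrite !fixword_long; try lia.
by move: t t8 => [|[|[|[|[|[|[|[|]]]]]]]].
Qed.

(* [P] is now the exact length of the common extension to the right. *)
Definition xblocks (T : Type) (z : nat -> T) (a b P S : nat) y e :=
  blocks z a b P S y e /\
  (forall k k', y k <> y k' -> z (e k + P) <> z (e k' + P)).

Lemma blocks_word (T : Type) (z : nat -> T) a b P S y e k w : blocks z a b P S y e ->
  (forall t, t < size w -> y (k + t) = nth false w t) ->
  e (k + size w) = e k + (a * count id w + b * count negb w).
Proof.
move=> B; elim: w k => [|c w IH] k h; first by rewrite /= !muln0 !addn0.
have h0 : y k = c by have := h 0 isT; rewrite addn0.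
rewrite [size _]/= addnS -addSn IH.
  by rewrite (bl_step B) h0; case: (c) => /=; lia.
by move=> t tw; have := h t.+1; rewrite addnS -addSn; apply.
Qed.

(** The right extension grows by the ten common letters, of total length 4a + 6b, and remains exact
    by [fixword_exact]; the left one grows by [b] because both images end in 0. *)
Lemma xblocks_step (T : Type) (z : nat -> T) a b P S e :
  xblocks z a b P S fixword e ->
  xblocks z (3 * a + 5 * b) (2 * a + 3 * b) (P + 4 * a + 6 * b) (S + b)
    fixword (e \o block_pos).
Proof.
move=> [B X].
have W10 k : e (block_pos k + 10) = e (block_pos k) + (4 * a + 6 * b).
  by rewrite (blocks_word (w := phi true ++ [:: true; false]) B) /=; [lia | exact: fixword_long].
have step k : e (block_pos k.+1) = e (block_pos k) +
    (if fixword k then 3 * a + 5 * b else 2 * a + 3 * b).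
  rewrite block_posS; have := blocks_word (k := block_pos k) (w := phi (fixword k)) B.
  have := @fixword_block k.
  by case: (fixword k) => /= h1 h2; rewrite h2 //; lia.
have A10 k k' : agree fixword (block_pos k) (block_pos k') 10.
  by move=> t t10; rewrite !fixword_long.
split; first split=> //=.
- by rewrite (bl_start B).
- move=> k k' ekk'.
  have [|_] := blocks_agree (k := block_pos k) (k' := block_pos k')
    (n := if fixword k then 8 else 5) B.
    by move=> t tl; rewrite !fixword_block -?ekk'.
  by rewrite -block_posS step addKn; apply: agree_le; lia.
- move=> k k'; have [_] := blocks_agree B (A10 k k').
  by rewrite W10; apply: agree_le; lia.
- move=> [|k] [|k'] t /=; rewrite ?block_pos0 ?(bl_start B); try by move=> *; lia.
  have [m -> p1] := fixword_last k; have [m' -> p2] := fixword_last k'.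
  rewrite !(bl_step B) p1 p2 => tS tk tk'.
  case: (ltnP t b) => tb.
    have := bl_eq B (k := m) (k' := m'); rewrite p1 p2 => /(_ erefl).
    by move=> /(_ (b - t.+1)) h; rewrite -!addnBA //; apply: h; lia.
  have := bl_left B (k := m) (k' := m') (t := t - b).
  have -> : e m + b - t.+1 = e m - (t - b).+1 by lia.
  have -> : e m' + b - t.+1 = e m' - (t - b).+1 by lia.
  by apply; lia.
- move=> k k' ne /=.
  have eP u : e (block_pos u) + (P + 4 * a + 6 * b) = e (block_pos u + 10) + P by rewrite W10; lia.
  by rewrite !eP; apply: X; rewrite !fixword_exact => /negb_inj.
Qed.

Definition xrepeat (T : Type) (z : nat -> T) (i d N : nat) :=
  [/\ 0 < d, agree z i (i + d) N & z (i + N) <> z (i + d + N)].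

(** The common part consists of [m] letters on the left, the blocks on which the codes agree, and
    the exact extension [P] beyond them. *)
Lemma xblocks_repeat (T : Type) (z : nat -> T) a b P S y e k k' n m :
  xblocks z a b P S y e -> e k < e k' ->
  agree y k k' n -> y (k + n) <> y (k' + n) ->
  m <= e k -> agree z (e k - m) (e k' - m) m ->
  xrepeat z (e k - m) (e k' - e k) (m + (e (k + n) - e k) + P).
Proof.
move=> [B X] lt A N mk L; have [l A'] := blocks_agree B A.
have M := blocks_mono B k n.
split; first lia.
  rewrite -addnA; apply: agree_cat.
    by apply: (agree_cast L) => //; lia.
  by apply: (agree_cast A'); lia.
have -> : e k - m + (m + (e (k + n) - e k) + P) = e (k + n) + P by lia.
have -> : e k - m + (e k' - e k) + (m + (e (k + n) - e k) + P) = e (k' + n) + P by lia.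
exact: X.
Qed.

Definition fixprefix := [:: true; false; false; true; false; true; false; false;
  true; false; false; true; false; true].

Lemma fixword_prefix t : t < 14 -> fixword t = nth false fixprefix t.
Proof.
move=> t14; rewrite (@fixwordE 2); last by apply: leq_trans t14 _.
by move: t t14 => [|[|[|[|[|[|[|[|[|[|[|[|[|[|]]]]]]]]]]]]]].
Qed.

(* With (J, N) for the repetition of record [i], J of each record equals N of the previous
   one up to a constant, the next one after [record6] being [record1] of the next stage. *)
Section Records.
Variables (T : Type) (z : nat -> T) (a b P S : nat) (e : nat -> nat).
Hypothesis X : xblocks z a b P S fixword e.
Hypothesis S_le_a : S <= a.
Hypothesis a_gt0 : 0 < a.
Hypothesis b_gt0 : 0 < b.

Let pos t : t < 14 ->
  e t = a * count id (take t fixprefix) + b * count negb (take t fixprefix).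
Proof.
move=> t14; have sz : size (take t fixprefix) = t by rewrite size_takel //; apply: ltnW.
have := blocks_word (k := 0) (w := take t fixprefix) X.1.
rewrite sz (bl_start X.1) !add0n; apply=> i it.
by rewrite nth_take // fixword_prefix //; lia.
Qed.

Let prefix_agree i j n : i + n < 14 -> j + n < 14 ->
  all (fun t => nth false fixprefix (i + t) == nth false fixprefix (j + t)) (iota 0 n) ->
  agree fixword i j n.
Proof.
move=> hi hj /allP h t tn; rewrite !fixword_prefix; try lia.
by apply/eqP/h; rewrite mem_iota.
Qed.

Let left i j m : m <= S -> m <= e i -> m <= e j -> agree z (e i - m) (e j - m) m.
Proof.
move=> mS mi mj t tm; have := bl_left X.1 (k := i) (k' := j) (t := m - t.+1).
have -> : e i - (m - t.+1).+1 = e i - m + t by lia.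
have -> : e j - (m - t.+1).+1 = e j - m + t by lia.
by apply; lia.
Qed.

Let left_block i j : fixword i = false -> fixword j = false -> S <= e i -> S <= e j ->
  agree z (e i.+1 - (S + b)) (e j.+1 - (S + b)) (S + b).
Proof.
move=> fi fj Si Sj; rewrite !(bl_step X.1) fi fj !subnDr.
apply: agree_cat; first exact: left.
have := bl_eq X.1 (k := i) (k' := j); rewrite fi fj => /(_ erefl) A.
by apply: (agree_cast A); lia.
Qed.

Let e1 : e 1 = a. Proof. by rewrite pos //=; lia. Qed.
Let e2 : e 2 = a + b. Proof. by rewrite pos //=; lia. Qed.
Let e3 : e 3 = a + 2 * b. Proof. by rewrite pos //=; lia. Qed.
Let e4 : e 4 = 2 * a + 2 * b. Proof. by rewrite pos //=; lia. Qed.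
Let e5 : e 5 = 2 * a + 3 * b. Proof. by rewrite pos //=; lia. Qed.
Let e7 : e 7 = 3 * a + 4 * b. Proof. by rewrite pos //=; lia. Qed.
Let e8 : e 8 = 3 * a + 5 * b. Proof. by rewrite pos //=; lia. Qed.
Let e10 : e 10 = 4 * a + 6 * b. Proof. by rewrite pos //=; lia. Qed.

Lemma record1 : xrepeat z 0 a P.
Proof.
have := xblocks_repeat (k := 0) (k' := 1) (n := 0) (m := 0) X.
rewrite (bl_start X.1) e1 !subn0 add0n; exact.
Qed.

Lemma record2 : xrepeat z (a - S) b (S + b + P).
Proof.
have := xblocks_repeat (k := 1) (k' := 2) (n := 1) (m := S) X.
rewrite e1 e2 addKn; apply; first lia.
- exact: prefix_agree.
- by rewrite !fixword_prefix.
- by [].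
- by have := @left 1 2 S; rewrite e1 e2; apply=> //; lia.
Qed.

Lemma record3 : xrepeat z 0 (a + 2 * b) (a + b + P).
Proof.
have := xblocks_repeat (k := 0) (k' := 3) (n := 2) (m := 0) X.
rewrite (bl_start X.1) e3 e2 !subn0 add0n; apply=> //; first lia.
exact: prefix_agree.
Qed.

Lemma record4 : xrepeat z (a + b - S) (a + b) (S + b + (a + b) + P).
Proof.
have := xblocks_repeat (k := 3) (k' := 5) (n := 2) (m := S + b) X.
have -> : a + b - S = e 3 - (S + b) by rewrite e3; lia.
have -> : a + b = e 5 - e 3 by rewrite e3 e5; lia.
rewrite (_ : e (3 + 2) = e 5) //; apply; rewrite ?e3 ?e5; try lia.
- exact: prefix_agree.
- by rewrite !fixword_prefix.
- by have := @left_block 2 4; rewrite e2 e3 e4 e5 !fixword_prefix //; apply=> //; lia.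
Qed.

Lemma record5 : xrepeat z 0 (2 * a + 3 * b) (2 * a + 3 * b + P).
Proof.
have := xblocks_repeat (k := 0) (k' := 5) (n := 5) (m := 0) X.
rewrite (bl_start X.1) e5 !subn0 add0n; apply=> //; first lia.
exact: prefix_agree.
Qed.

Lemma record6 :
  xrepeat z (2 * a + 2 * b - S) (a + 2 * b) (S + b + (2 * a + 3 * b) + P).
Proof.
have := xblocks_repeat (k := 5) (k' := 8) (n := 5) (m := S + b) X.
have -> : 2 * a + 2 * b - S = e 5 - (S + b) by rewrite e5; lia.
have -> : a + 2 * b = e 8 - e 5 by rewrite e5 e8; lia.
have -> : 2 * a + 3 * b = e 10 - e 5 by rewrite e5 e10; lia.
rewrite (_ : e (5 + 5) = e 10) //; apply; rewrite ?e8 ?e5; try lia.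
- exact: prefix_agree.
- by rewrite !fixword_prefix.
- by have := @left_block 4 7; rewrite e4 e5 e7 e8 !fixword_prefix //; apply=> //; lia.
Qed.

End Records.

(* Up to length P + 1, a factor starting at distance [s] before a boundary depends only on
   [s] if [s <= S], and only on [s] and the block otherwise: this leaves a + b - S cases. *)
Lemma xblocks_words (T : finType) (z : nat -> T) a b P S e :
  xblocks z a b P S fixword e -> S <= a -> S <= b -> 0 < a -> 0 < b ->
  P + S + 2 = a + b ->
  #|words z P.+1| <= P.+2.
Proof.
move=> X Sa Sb a0 b0 PS; have B := X.1.
have y0 : fixword 0 = true by [].
have y1 : fixword 1 = false by [].
have e1 : e 1 = a by rewrite (bl_step B) (bl_start B) y0.
have e2 : e 2 = a + b by rewrite (bl_step B) e1 y1.
have short l : exists2 l', l' < P.+2 & agree z l l' P.+1.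
  have [k [kl lk]] : exists k, e k <= l /\ l < e k.+1.
    have ex : exists k, l < e k.
      exists l.+1; have : l.+1 <= e l.+1; last by [].
      by elim: l.+1 => // n IH; rewrite (bl_step B); case: (fixword n); lia.
    case: (ex_minnP ex) => [[|k]]; first by rewrite (bl_start B).
    move=> lk kmin; exists k; split=> //; rewrite leqNgt; apply/negP => /kmin; lia.
  have right k' : agree z (e k.+1) (e k') P by apply: (bl_right B).
  pose s := e k.+1 - l.
  have [s0 sl] : 0 < s /\ l = e k.+1 - s by rewrite /s; lia.
  have step := bl_step B k.
  have ext k' : s <= e k' -> agree z l (e k' - s) s ->
      agree z l (e k' - s) P.+1.
    move=> sk A; apply: (@agree_le _ _ _ _ _ (s + P)); first by lia.
    apply: agree_cat => //; apply: (agree_cast (right k')); lia.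
  case: (leqP s S) => sS.
    exists (e 1 - s); first by rewrite e1; lia.
    apply: ext; first by rewrite e1; lia.
    move=> t ts; have := bl_left B (k := k.+1) (k' := 1) (t := s - t.+1).
    have -> : e k.+1 - (s - t.+1).+1 = l + t by lia.
    have -> : e 1 - (s - t.+1).+1 = e 1 - s + t by rewrite e1; lia.
    by apply; rewrite ?e1; lia.
  have inblock k' : fixword k' = fixword k -> agree z l (e k'.+1 - s) P.+1.
    move=> ekk'; have step' := bl_step B k'; rewrite ekk' in step'.
    apply: ext; first by lia.
    have A := bl_eq B (esym ekk').
    have [c ec] : {c | (if fixword k then a else b) = c} by exists (if fixword k then a else b).
    rewrite ec in A step step'.
    have A' : agree z (e k) (e k') ((c - s) + s) by apply: (agree_le _ A); lia.
    by apply: (agree_cast (agree_shift A')); lia.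
  case E: (fixword k) step => step.
    exists (e 1 - s); first by rewrite e1; lia.
    by apply: inblock; rewrite E.
  (* Since [s] exceeds [S], this position is below a + b - S = P + 2. *)
  exists (e 2 - s); first by rewrite e2; lia.
  by apply: inblock; rewrite E.
have sub : words z P.+1 \subset [set word z P.+1 l | l : 'I_P.+2].
  apply/fintype.subsetP => w /wordsP [l ->]; have [l' lt A] := short l.
  by apply/imsetP; exists (Ordinal lt) => //; apply/word_agree.
by apply: leq_trans (subset_leq_card sub) _; rewrite -[X in _ <= X]card_ord leq_imset_card.
Qed.

(** * Growth along the period XZZZ *)

Local Open Scope classical_set_scope.
Local Open Scope ring_scope.

(** One less than the critical exponent: repetitions with N about kappa J give approximations of
    exponent 1 + kappa. *)
Definition kappa0 (R : realType) : R := 2 / 3 + 4 / 15 * Num.sqrt 10.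

Lemma nat_gt (R : realType) (x : R) : exists n : nat, x < n%:R.
Proof. by exists (Num.bound `|x|); apply: le_lt_trans (ler_norm x) _; apply: archi_boundP. Qed.

(* [hs] is the effect of the four moves XZZZ. *)
Section Period.
Variables (R : realType) (a b p : nat -> nat).
Hypothesis a_gt0 : forall j, (0 < a j)%N.
Hypothesis b_gt0 : forall j, (0 < b j)%N.
Hypothesis hs : forall j, [/\ a j.+1 = (3 * a j + 5 * b j)%N,
  b j.+1 = (2 * a j + 3 * b j)%N & p j.+1 = (p j + 4 * a j + 6 * b j)%N].

Lemma period_unbounded j : (j <= a j)%N.
Proof. by elim: j => // j IH; have [-> _ _] := hs j; have := a_gt0 j; lia. Qed.

Lemma period_cast j : [/\ (a j.+1)%:R = 3 * (a j)%:R + 5 * (b j)%:R :> R,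
  (b j.+1)%:R = 2 * (a j)%:R + 3 * (b j)%:R :> R &
  (p j.+1)%:R = (p j)%:R + 4 * (a j)%:R + 6 * (b j)%:R :> R].
Proof.
have [-> -> ->] := hs j.
split; first by rewrite (natrD _ (3 * a j)%N) !natrM.
  by rewrite (natrD _ (2 * a j)%N) !natrM.
by rewrite (natrD _ (p j + 4 * a j)%N) (natrD _ (p j)) !natrM.
Qed.

(** One period changes the sign of the form 2a^2 - 5b^2. *)
Lemma period_form j :
  (`| 2 * (a j)%:R ^+ 2 - 5 * (b j)%:R ^+ 2 | = `| 2 * (a 0)%:R ^+ 2 - 5 * (b 0)%:R ^+ 2 | :> R).
Proof.
elim: j => // j <-; have [-> -> _] := period_cast j; rewrite -normrN; congr (`| _ |).
by ring.
Qed.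

Lemma period_linear j :
  (3 * (p j)%:R - 2 * (a j)%:R - 4 * (b j)%:R = 3 * (p 0)%:R - 2 * (a 0)%:R - 4 * (b 0)%:R :> R).
Proof.
elim: j => // j <-; have [-> -> ->] := period_cast j.
by ring.
Qed.

(** The bounded form is, up to the factor -1/5, the product of 5b - sqrt 10 a and its conjugate,
    which is at least 1. *)
Lemma period_ratio : exists D : R, forall j,
  `| 5 * (b j)%:R - Num.sqrt 10 * (a j)%:R | <= D.
Proof.
exists (5 * `| 2 * (a 0)%:R ^+ 2 - 5 * (b 0)%:R ^+ 2 |) => j.
rewrite -(period_form j).
set s := Num.sqrt 10; have ss : s ^+ 2 = 10 by rewrite sqr_sqrtr.
have s0 : 0 <= s by apply: sqrtr_ge0.
have A : 1 <= (a j)%:R :> R by rewrite ler1n.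
have B : 1 <= (b j)%:R :> R by rewrite ler1n.
have -> : 2 * (a j)%:R ^+ 2 - 5 * (b j)%:R ^+ 2 =
    - (5 * (b j)%:R - s * (a j)%:R) * (5 * (b j)%:R + s * (a j)%:R) / 5 :> R.
  have -> : - (5 * (b j)%:R - s * (a j)%:R) * (5 * (b j)%:R + s * (a j)%:R) / 5 =
     (s ^+ 2 * (a j)%:R ^+ 2 - 25 * (b j)%:R ^+ 2) / 5 :> R by field.
  by rewrite ss; field.
have sa : 0 <= s * (a j)%:R by apply: mulr_ge0.
rewrite !normrM normrN (ger0_norm (x := 5 * (b j)%:R + s * (a j)%:R)); last by lra.
rewrite (ger0_norm (x := 5^-1)) ?invr_ge0 //.
have := normr_ge0 (5 * (b j)%:R - s * (a j)%:R).
set u := `| _ |; set v := 5 * (b j)%:R + s * (a j)%:R => u0.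
have v1 : 1 <= v by rewrite /v; lra.
have : u * 1 <= u * v by apply: ler_wpM2l.
by lra.
Qed.

(** Eliminating b between [period_linear] and [period_ratio] gives p = kappa0 a up to a bounded
    error, while a is unbounded. *)
Lemma period_escape (kappa C : R) : kappa < kappa0 R ->
  exists j, kappa * (a j)%:R + C < (p j)%:R.
Proof.
move=> kk; have [D hD] := period_ratio.
set I : R := 3 * (p 0)%:R - 2 * (a 0)%:R - 4 * (b 0)%:R.
pose d := kappa0 R - kappa; have d0 : 0 < d by rewrite subr_gt0.
have [n hn] := nat_gt ((3 * C + D - I) / (3 * d)).
exists n; have := period_linear n; rewrite -/I.
have := hD n; rewrite ler_norml => /andP [h1 _].
move: hn; rewrite ltr_pdivrMr; last by lra.
have na : n%:R <= (a n)%:R :> R by rewrite ler_nat period_unbounded.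
have : n%:R * (3 * d) <= (a n)%:R * (3 * d) by apply: ler_wpM2r => //; lra.
have -> : (a n)%:R * (3 * d) = 2 * (a n)%:R + 4 / 5 * (Num.sqrt 10 * (a n)%:R) - 3 * (kappa * (a n)%:R).
  by rewrite /d /kappa0; field.
move=> h2 h3 h4.
have D0 : 0 <= D by apply: le_trans (hD 0).
by lra.
Qed.

End Period.

(** * Bounded ratios lead to a contradiction *)

Section Game.
Variables (R : realType) (kappa C : R).
Variables (m : nat -> move) (a b p : nat -> nat).
Hypothesis kk : kappa < kappa0 R.
Hypothesis a0 : forall k, (0 < a k)%N.
Hypothesis b0 : forall k, (0 < b k)%N.
Hypothesis hm : forall k, moved (m k) (a k) (b k) (p k) (a k.+1) (b k.+1) (p k.+1).
Hypothesis hF : forall k, (p k)%:R <= kappa * (a k)%:R + C.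
Hypothesis hG : forall k, m k <> MY ->
  (a k + p k)%:R <= kappa * (b k)%:R + C \/ (a k + b k)%:R <= kappa * (p k)%:R + C.

Let kappa_lt : kappa < 151 / 100.
Proof.
move: kk; rewrite /kappa0.
set s := Num.sqrt 10; have ss : s ^+ 2 = 10 by rewrite sqr_sqrtr.
have s0 : 0 <= s by apply: sqrtr_ge0.
move=> hs; rewrite ltNge; apply/negP => h.
(* 253/80 solves 2/3 + 4/15 s = 151/100, and its square exceeds 10. *)
have h1 : 253 / 80 <= s by lra.
have : s * (253 / 80) <= s * s by apply: ler_wpM2l.
by rewrite -expr2 ss; lra.
Qed.

Let step k : [\/ m k = MX /\ [/\ a k.+1 = a k + b k, b k.+1 = b k & p k.+1 = p k],
  m k = MY /\ [/\ a k.+1 = a k, b k.+1 = a k + b k & p k.+1 = p k + a k] |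
  m k = MZ /\ [/\ a k.+1 = a k + b k, b k.+1 = a k & p k.+1 = p k + a k]]%N.
Proof.
move: (hm k); case: (m k) => h; [apply: Or31 | apply: Or32 | apply: Or33]; by split.
Qed.

(** Under X alone [b] and [p] are frozen while [a] grows, against both alternatives of [hG]. *)
Let not_always_X K : exists2 k, (K <= k)%N & m k <> MX.
Proof.
apply: contrapT => H.
have hX n : m (K + n)%N = MX.
  by apply: contrapT => ne; apply: H; exists (K + n)%N => //; lia.
have st n : [/\ n <= a (K + n), b (K + n) = b K & p (K + n) = p K]%N.
  elim: n => [|n [h1 h2 h3]]; first by rewrite addn0.
  have b1 := b0 (K + n)%N.
  by rewrite addnS; case: (step (K + n)) => -[]; rewrite hX // => _ [-> -> ->]; split; lia.
have [n1 h1] := nat_gt (kappa * (b K)%:R + C).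
have [n2 h2] := nat_gt (kappa * (p K)%:R + C).
have [ge eb ep] := st (n1 + n2)%N.
have := hG (k := (K + (n1 + n2))%N); rewrite hX eb ep; case=> // h.
  have : n1%:R <= (a (K + (n1 + n2)) + p K)%:R :> R by rewrite ler_nat; lia.
  by lra.
have : n2%:R <= (a (K + (n1 + n2)) + b K)%:R :> R by rewrite ler_nat; lia.
by lra.
Qed.

(** Under Y alone [a] is frozen while [p] grows, against [hF]. *)
Let not_always_Y K : exists2 k, (K <= k)%N & m k <> MY.
Proof.
apply: contrapT => H.
have hY n : m (K + n)%N = MY.
  by apply: contrapT => ne; apply: H; exists (K + n)%N => //; lia.
have st n : [/\ n <= p (K + n) & a (K + n) = a K]%N.
  elim: n => [|n [h1 h2]]; first by rewrite addn0.
  have b1 := a0 (K + n)%N.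
  by rewrite addnS; case: (step (K + n)) => -[]; rewrite hY // => _ [-> _ ->]; split; lia.
have [n h] := nat_gt (kappa * (a K)%:R + C).
have [ge ea] := st n; have := hF (K + n); rewrite ea => h1.
have : n%:R <= (p (K + n))%:R :> R by rewrite ler_nat.
by lra.
Qed.

Let unbounded (f : nat -> nat) (m0 : move) :
  (forall k, f k <= f k.+1)%N -> (forall k, m k <> m0 -> f k < f k.+1)%N ->
  (forall K, exists2 k, (K <= k)%N & m k <> m0) ->
  forall M, exists K, forall k, (K <= k)%N -> (M <= f k)%N.
Proof.
move=> f1 f2 h.
have mono K n : (f K <= f (K + n))%N.
  by elim: n => [|n IH]; rewrite ?addn0 // addnS; have := f1 (K + n)%N; lia.
elim=> [|M [K HK]]; first by exists 0%N.
have [k Kk mk] := h K; exists k.+1 => l kl.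
have := mono k.+1 (l - k.+1)%N; rewrite subnKC //.
by have := f2 k mk; have := HK k Kk; lia.
Qed.

(** [a] grows except at Y and [p] except at X; each move other than X makes [b] at least the
    previous [a]. *)
Let large M : exists K, forall k, (K <= k)%N -> [/\ M <= a k, M <= b k & M <= p k]%N.
Proof.
have [K1 h1] : exists K, forall k, (K <= k)%N -> (M <= a k)%N.
  apply: (@unbounded a MY) => // k; case: (step k) => -[mk [-> _ _]]; have := b0 k; try lia.
  by rewrite mk.
have [K2 h2] : exists K, forall k, (K <= k)%N -> (M <= p k)%N.
  apply: (@unbounded p MX) => // k; case: (step k) => -[mk [_ _ ->]]; have := a0 k; try lia.
  by rewrite mk.
have [k3 K3 m3] := not_always_X (maxn K1 K2).
have h3 n : (M <= b (k3.+1 + n))%N.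
  elim: n => [|n IH].
    rewrite addn0; have := h1 k3; case: (step k3) => -[mk [_ -> _]]; try lia.
    by rewrite mk in m3.
  have := h1 (k3.+1 + n)%N; rewrite addnS.
  by case: (step (k3.+1 + n)) => -[mk [_ -> _]]; lia.
exists k3.+1 => k lk; split; [apply: h1; lia | | apply: h2; lia].
by rewrite -(subnKC lk).
Qed.

(** The gap between [kappa] and 151/100 absorbs [C] once the lengths are large. *)
Let eventually_tight : exists K, forall k, (K <= k)%N -> tight (m k) (a k) (b k) (p k).
Proof.
have d0 : 0 < 151 / 100 - kappa by rewrite subr_gt0.
have [M hM] := nat_gt (C / (151 / 100 - kappa)).
have [K hK] := large M; exists K => k /hK [ak bk pk].
have absorb (u v : nat) : (M <= v)%N -> u%:R <= kappa * v%:R + C -> (100 * u <= 151 * v)%N.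
  move=> Mv h; rewrite -(ler_nat R) !natrM.
  have Mv' : M%:R <= v%:R :> R by rewrite ler_nat.
  have : C < (151 / 100 - kappa) * M%:R by rewrite mulrC -ltr_pdivrMr.
  have : (151 / 100 - kappa) * M%:R <= (151 / 100 - kappa) * v%:R.
    by apply: ler_wpM2l => //; apply: ltW.
  by lra.
split=> //; first exact: absorb.
by move=> /hG [h|h]; [left | right]; apply: absorb.
Qed.

Lemma tight_ratios_absurd : False.
Proof.
have [K hK] := eventually_tight.
pose sh (T : Type) (f : nat -> T) n := f (K + n)%N.
have hm1 n : moved (sh _ m n) (sh _ a n) (sh _ b n) (sh _ p n)
   (sh _ a n.+1) (sh _ b n.+1) (sh _ p n.+1).
  by rewrite /sh addnS.
have ht1 n : tight (sh _ m n) (sh _ a n) (sh _ b n) (sh _ p n).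
  by apply: hK; lia.
have noY1 := tight_no_Y hm1 ht1.
(* [tight_no_Y] excludes a Y only after seven earlier moves. *)
pose L := (K + 7)%N.
have e1 n : (L + n = K + n.+4.+3)%N by rewrite /L; lia.
have hm2 n : moved (m (L + n)%N) (a (L + n)%N) (b (L + n)%N) (p (L + n)%N)
   (a (L + n.+1)%N) (b (L + n.+1)%N) (p (L + n.+1)%N).
  by rewrite addnS.
have ht2 n : tight (m (L + n)%N) (a (L + n)%N) (b (L + n)%N) (p (L + n)%N).
  by apply: hK; rewrite /L; lia.
have noY n : m (L + n)%N <> MY by rewrite e1; apply: noY1.
have [x hx] : exists n, m (L + n)%N = MX.
  apply: contrapT => H; have hZ n : m (L + n)%N = MZ.
    by case E: (m (L + n)%N) => //; [case: H; exists n | case: (noY n)].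
  by apply: (tight_not_all_Z hm2 ht2 (k := 0)); rewrite !hZ.
have after n := tight_after_X hm2 ht2 noY (k := n).
(* By [tight_after_X], XX is followed by X, hence by X forever. *)
have noXX n : m (L + n)%N = MX -> m (L + n.+1)%N <> MX.
  move=> m1 m2; have [k kL nk] := not_always_X (L + n); apply: nk.
  have both t : m (L + (n + t))%N = MX /\ m (L + (n + t).+1)%N = MX.
    elim: t => [|t [h1 h2]]; first by rewrite addn0.
    rewrite addnS; split=> //; have [[]|[]] := after _ h1 => //.
    by rewrite h2.
  have [h _] := both (k - (L + n))%N; move: h.
  by have -> : (L + (n + (k - (L + n))) = k)%N by lia.
have XZZZ n : m (L + n)%N = MX -> [/\ m (L + n.+1)%N = MZ, m (L + n.+2)%N = MZ,
    m (L + n.+3)%N = MZ & m (L + n.+4)%N = MX].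
  by move=> h; have [[h1 _]|] := after _ h; first by case: (noXX _ h).
pose q j := (L + (x + 4 * j))%N.
have mq j : m (q j) = MX.
  elim: j => [|j IH]; first by rewrite /q muln0 addn0.
  have [_ _ _ <-] := XZZZ _ IH; congr m; rewrite /q; lia.
have hs j : [/\ a (q j.+1) = (3 * a (q j) + 5 * b (q j))%N,
    b (q j.+1) = (2 * a (q j) + 3 * b (q j))%N & p (q j.+1) = (p (q j) + 4 * a (q j) + 6 * b (q j))%N].
  have [z1 z2 z3 _] := XZZZ _ (mq j).
  have -> : q j.+1 = (L + (x + 4 * j).+4)%N by rewrite /q; lia.
  move: (hm2 (x + 4 * j)%N) (hm2 (x + 4 * j).+1) (hm2 (x + 4 * j).+2) (hm2 (x + 4 * j).+3).
  rewrite z1 z2 z3 mq -/(q j) => -[-> -> ->] [-> -> ->] [-> -> ->] [-> -> ->].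
  by split; lia.
have [j] := period_escape (a := a \o q) (b := b \o q) (p := p \o q)
  (fun j => a0 _) (fun j => b0 _) hs C kk.
by have := hF (q j); rewrite leNgt => /negP.
Qed.

End Game.

Lemma level_sequence (T : Type) (z : nat -> T) C0 a0 b0 P0 :
  aperiodic z -> level z C0 a0 b0 P0 ->
  exists (m : nat -> move) (a b P : nat -> nat),
  [/\ forall k, level z C0 (a k) (b k) (P k),
      forall k, moved (m k) (a k) (b k) (P k) (a k.+1) (b k.+1) (P k.+1) &
      forall k, m k <> MY -> inner_repeat z C0 (a k) (b k) (P k)].
Proof.
move=> za l0.
pose S := {s : nat * nat * nat | level z C0 s.1.1 s.1.2 s.2}.
pose next (s : S) (t : S * move) :=
  moved t.2 (sval s).1.1 (sval s).1.2 (sval s).2 (sval t.1).1.1 (sval t.1).1.2 (sval t.1).2 /\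
  (t.2 <> MY -> inner_repeat z C0 (sval s).1.1 (sval s).1.2 (sval s).2).
have [f hf] : {f : S -> S * move & forall s, next s (f s)}.
  apply: choice => -[[[a b] P] l]; have [a' [b' [P' [l' h]]]] := level_step za l.
  pose s' : S := exist _ (a', b', P') l'.
  case: h => [[*] | [*] | [*]];
    [exists (s', MX) | exists (s', MY) | exists (s', MZ)]; by split.
pose s k := iter k (fun s => (f s).1) (exist _ (a0, b0, P0) l0 : S).
exists (fun k => (f (s k)).2), (fun k => (sval (s k)).1.1), (fun k => (sval (s k)).1.2),
  (fun k => (sval (s k)).2); split=> k.
- exact: (proj2_sig (s k)).
- by have [] := hf (s k).
- by have [] := hf (s k).
Qed.

Lemma repeats_unbounded (R : realType) (T : finType) (x : nat -> T) n0 (kappa C : R) :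
  aperiodic x -> (forall n, (n0 <= n)%N -> special_unique x n) ->
  0 <= kappa -> kappa < kappa0 R ->
  ~ (forall J N, repeats x J N -> N%:R <= kappa * J%:R + C).
Proof.
move=> xa sp k0 kk H.
have [i [j [_ _ A N]]] := aperiodic_special 0 n0 xa.
have [s [C0 [a0 [b0 l0]]]] := return_level xa sp A N.
pose z t := x (s + t)%N; rewrite -/z in l0.
have za : aperiodic z.
  move=> M d d0; have [l Ml ne] := xa (s + M)%N d d0.
  exists (l - s)%N; first lia; rewrite /z addnA.
  by have -> : (s + (l - s) = l)%N by lia.
have Hz J M : repeats z J M -> M%:R <= kappa * (s + J)%:R + C.
  move=> [u [d [d0 e Az]]]; apply: H; exists (s + u)%N, d; split=> //; first lia.
  by move=> t tM; have := Az t tM; rewrite /z !addnA.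
have [m [a [b [P [hl hm hG]]]]] := level_sequence za l0.
(* The constant absorbs the shift [s] of the origin and the offset [C0] in the inner repetitions. *)
apply: (@tight_ratios_absurd R kappa (kappa * (s + C0)%:R + C + C0%:R) m a b P) => //.
- by move=> k; case: (hl k).
- by move=> k; case: (hl k).
- move=> k; have := Hz _ _ (level_front (hl k)).
  rewrite !natrD !mulrDr => h.
  have : 0 <= kappa * C0%:R by apply: mulr_ge0.
  by have : 0 <= C0%:R :> R by []; lra.
- move=> k /hG [h|[M h MC]]; [left|right].
    have := Hz _ _ h; rewrite !natrD !mulrDr => h'.
    have : 0 <= kappa * C0%:R by apply: mulr_ge0.
    by have : 0 <= C0%:R :> R by []; lra.
  by have := Hz _ _ h; rewrite -MC !natrD !mulrDr; lra.
Qed.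

(** * Digits and rational approximation *)

Lemma denq_le (p : int) (Q : nat) : (0 < Q)%N -> denq (p%:Q / Q%:Q) <= Q%:Z.
Proof.
rewrite -ltz_nat; case: divqP => [_ // | k r _ h].
by move: h; rewrite pmulr_lgt0 ?denq_gt0 // => h; apply: ler_peMl; rewrite ?denq_ge0 //; lia.
Qed.

Lemma exponent_finite (R : realType) (xi : R) :
  (irrationality_exponent xi < (1 + kappa0 R)%:E)%E ->
  exists kappa, [/\ 0 <= kappa, kappa < kappa0 R & finite_set
    [set r : rat | `| xi - ratr r | < ((denq r)%:~R : R) `^ (- (1 + kappa))] ].
Proof.
move=> mu_lt.
have kp : 0 < kappa0 R.
  by rewrite /kappa0; have : 0 <= Num.sqrt 10 :> R by apply: sqrtr_ge0; lra.
pose s := irrationality_exponent xi.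
have [kappa [k0 kk sk]] : exists kappa, [/\ 0 <= kappa, kappa < kappa0 R & (s < (1 + kappa)%:E)%E].
  move: mu_lt; rewrite -/s; case: s => [r | // | _].
    (* The midpoint of mu - 1 and [kappa0], replaced by 0 if negative. *)
    rewrite lte_fin => rk; exists (Num.max 0 ((r - 1 + kappa0 R) / 2)).
    split; first by rewrite le_max lexx.
      by rewrite gt_max kp /=; lra.
    by rewrite lte_fin addrC -ltrBlDr lt_max; apply/orP; right; lra.
  by exists 0; split=> //; apply: ltNyr.
exists kappa; split=> //; apply: contrapT => inf.
move: sk; rewrite ltNge => /negP; apply; apply: ereal_sup_ubound.
by exists (1 + kappa).
Qed.

Section Digits.
Variables (R : realType) (xi : R) (b : nat).
Hypothesis b2 : (2 <= b)%N.

Definition frac l : R := b%:R ^+ l * xi - (Num.floor (b%:R ^+ l * xi))%:~R.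

Let bR : 2 <= b%:R :> R. Proof. by rewrite ler_nat. Qed.
Let b_gt1 : 1 < b%:R :> R. Proof. by have := bR; lra. Qed.
Let b_gt0 : 0 < b%:R :> R. Proof. by have := bR; lra. Qed.
Let bX_gt0 n : 0 < b%:R ^+ n :> R. Proof. exact: exprn_gt0. Qed.

Lemma frac_itv l : 0 <= frac l < 1.
Proof.
rewrite /frac; have /andP [h1 h2] := floor_itv (b%:R ^+ l * xi).
by move: h2; rewrite intrD => h2; apply/andP; split; lra.
Qed.

Lemma digit_floor l : (digit xi b l.+1)%:Z =
  Num.floor (b%:R ^+ l.+1 * xi) - b%:Z * Num.floor (b%:R ^+ l * xi).
Proof.
rewrite /digit /= gez0_abs // subr_ge0 floor_ge_int intrM exprS -mulrA.
by apply: ler_wpM2l; [rewrite ler0z | exact: floor_le].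
Qed.

Lemma frac_step l : b%:R * frac l = (digit xi b l.+1)%:R + frac l.+1.
Proof.
have /(congr1 (fun z : int => z%:~R : R)) := digit_floor l.
rewrite /= intrB intrM /frac exprS -!pmulrn => ->.
by ring.
Qed.

Lemma digit_lt l : (digit xi b l.+1 < b)%N.
Proof.
rewrite -(ltr_nat R); have := frac_step l.
have /andP [_ h1] := frac_itv l; have /andP [h2 _] := frac_itv l.+1.
have : b%:R * frac l < b%:R * 1 by rewrite ltr_pM2l.
by lra.
Qed.

Definition digits l : 'I_b := Ordinal (digit_lt l).

Lemma complexity_words n : complexity n xi b = #|words digits n|.
Proof.
rewrite /complexity; apply: eq_card => w; rewrite [in RHS]inE.
apply/idP/idP => [/set_mem /asboolP [l h]|/asboolP [l ->]].
  apply/asboolP; exists l; apply: eq_from_tnth => i; rewrite tnth_mktuple.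
  by apply: val_inj; rewrite /= h addn1.
by apply/mem_set/asboolP; exists l => i; rewrite tnth_mktuple /= addn1.
Qed.

Lemma frac_agree i j N : agree digits i j N ->
  b%:R ^+ N * (frac i - frac j) = frac (i + N) - frac (j + N).
Proof.
elim: N => [|N IH] h; first by rewrite !addn0 mul1r.
have := h N (ltnSn N) => /(congr1 val) /= e.
have {}IH := IH (agree_le (leqnSn N) h).
have := frac_step (i + N); have := frac_step (j + N); rewrite e !addnS => h1 h2.
by rewrite exprS -mulrA IH mulrBr h1 h2; ring.
Qed.

Definition period_den (i d : nat) : nat := (b ^ i * (b ^ d - 1))%N.

(** The number whose expansion repeats the digits of [xi] at positions [i + 1] to [i + d] forever
    after the first [i]; the fraction need not be reduced. *)
Definition approximant (i d : nat) : rat :=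
  (Num.floor (b%:R ^+ (i + d) * xi) - Num.floor (b%:R ^+ i * xi))%:Q /
  (period_den i d)%:Q.

Lemma period_den_gt0 i d : (0 < d)%N -> (0 < period_den i d)%N.
Proof.
move=> d0; rewrite muln_gt0 expn_gt0 (ltnW b2) /= subn_gt0.
by rewrite -(exp1n d) ltn_exp2r.
Qed.

Lemma period_den_le i d : (period_den i d <= b ^ (i + d))%N.
Proof. by rewrite expnD leq_mul2l leq_subr orbT. Qed.

Lemma approximant_den i d : (0 < d)%N -> denq (approximant i d) <= (period_den i d)%:Z.
Proof. by move=> d0; apply: denq_le; apply: period_den_gt0. Qed.

Lemma approximant_error i d : (0 < d)%N ->
  (period_den i d)%:R * (xi - ratr (approximant i d)) = frac (i + d) - frac i.
Proof.
move=> d0; have Q0 := period_den_gt0 i d0.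
rewrite /approximant fmorph_div /= !ratr_int -pmulrn.
have Qn : (period_den i d)%:R != 0 :> R by rewrite pnatr_eq0 -lt0n.
rewrite mulrBr mulrCA divff // mulr1 intrB /frac.
have -> : (period_den i d)%:R = b%:R ^+ (i + d) - b%:R ^+ i :> R.
  rewrite /period_den natrM natrB ?expn_gt0 ?(ltnW b2) // !natrX exprD; ring.
by ring.
Qed.

Lemma approximant_close i d N : (0 < d)%N -> agree digits i (i + d) N ->
  `| xi - ratr (approximant i d) | < b%:R ^- N / (period_den i d)%:R.
Proof.
move=> d0 A; have Q0 : 0 < (period_den i d)%:R :> R by rewrite ltr0n period_den_gt0.
rewrite ltr_pdivlMr // mulrC -[X in X * _](gtr0_norm Q0) -normrM approximant_error //.
rewrite -(ltr_pM2l (bX_gt0 N)) divff ?gt_eqF // -[X in X * _](gtr0_norm (bX_gt0 N)) -normrM.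
rewrite -normrN -mulrN opprB frac_agree //.
have /andP [h1 h2] := frac_itv (i + N); have /andP [h3 h4] := frac_itv (i + d + N).
by rewrite ltr_norml; apply/andP; split; lra.
Qed.

Hypothesis irr : irrational xi.

(** An eventual period would put [xi] within every [b ^- n] of one [approximant]. *)
Lemma digits_aperiodic : aperiodic digits.
Proof.
move=> N d d0; apply: contrapT => H.
have A n : agree digits N (N + d) n.
  move=> t _; apply: contrapT => ne; apply: H; exists (N + t)%N; first exact: leq_addr.
  by rewrite addnAC.
apply: irr; exists (approximant N d) => //.
apply/eqP; rewrite eq_sym -subr_eq0 -normr_eq0; apply/negPn/negP => h.
have e0 : 0 < `|xi - ratr (approximant N d)| by rewrite lt_def h normr_ge0.
have [n hn] := nat_gt (`|xi - ratr (approximant N d)|^-1).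
have := approximant_close d0 (A n); rewrite ltNge => /negP; apply.
have Q1 : 1 <= (period_den N d)%:R :> R by rewrite ler1n period_den_gt0.
apply: (@le_trans _ _ (b%:R ^- n)).
  by rewrite ler_pdivrMr ?ler_peMr ?invr_ge0 ?(ltW (bX_gt0 _)) //; lra.
rewrite invf_ple ?posrE //; apply: (le_trans (ltW hn)).
by rewrite -natrX ler_nat; apply: ltnW; apply: ltn_expl.
Qed.

(** A longer repetition makes its approximant one of the finitely many exceptional rationals, but
    closer to [xi] than the distance these keep by irrationality. *)
Lemma repeats_bounded (kappa : R) : 0 <= kappa ->
  finite_set [set r : rat | `| xi - ratr r | < ((denq r)%:~R : R) `^ (- (1 + kappa))] ->
  exists C : R, forall J N, repeats digits J N -> N%:R <= kappa * J%:R + C.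
Proof.
move=> k0 /finite_seqP [s hs].
have [n0 hn0] : exists n0, forall r, r \in s -> b%:R ^- n0 <= `| xi - ratr r |.
  elim: s {hs} => [|r s [n1 h1]]; first by exists 0%N.
  have e0 : 0 < `|xi - ratr r|.
    rewrite lt_def normr_ge0 andbT normr_eq0 subr_eq0; apply/eqP => e.
    by apply: irr; exists r.
  have [n2 hn2] := nat_gt (`|xi - ratr r|^-1).
  have big n : (n2 <= n)%N -> b%:R ^- n <= `|xi - ratr r|.
    move=> n2n; rewrite invf_ple ?posrE //; apply: (le_trans (ltW hn2)).
    rewrite -natrX ler_nat; apply: (leq_trans n2n); apply: ltnW; exact: ltn_expl.
  exists (n1 + n2)%N => t; rewrite inE => /orP [/eqP ->|/h1 h]; first by apply: big; lia.
  apply: le_trans h; rewrite lef_pV2 ?posrE //.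
  by rewrite ler_eXn2l //; lia.
exists n0%:R => J N [i [d [d0 eJ A]]]; rewrite leNgt; apply/negP => lt.
have Q0 := period_den_gt0 i d0.
have QR : 1 <= (period_den i d)%:R :> R by rewrite ler1n.
have close := approximant_close d0 A.
have QN : (period_den i d)%:R `^ kappa <= b%:R ^+ N :> R.
  apply: (@le_trans _ _ ((b%:R ^+ J) `^ kappa)).
    apply: ge0_ler_powR; rewrite ?nnegrE ?(ltW (bX_gt0 J)) //.
    by rewrite -natrX ler_nat -eJ period_den_le.
  rewrite -!powR_mulrn ?(ltW b_gt0) //.
  rewrite -powRrM; apply: ler_powR; first exact: ltW.
  by have : 0 <= n0%:R :> R by []; lra.
have mem : approximant i d \in s.
  have : [set` s] (approximant i d).
    rewrite -hs /=; apply: (lt_le_trans close).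
    apply: (@le_trans _ _ ((period_den i d)%:R `^ (- (1 + kappa)))).
      rewrite powRN powRD ?powRr1; last 2 first.
      - by lra.
      - by apply/implyP => _; rewrite gt_eqF //; lra.
      rewrite invfM mulrC ler_pM2l ?invr_gt0; last by lra.
      by rewrite lef_pV2 ?posrE // powR_gt0; lra.
    rewrite !powRN lef_pV2 ?posrE ?powR_gt0 ?ltr0z ?denq_gt0 //; last by lra.
    apply: ge0_ler_powR; rewrite ?nnegrE ?ler0z ?(ltW (denq_gt0 _)) //; try lra.
    by rewrite pmulrn ler_int approximant_den.
  by [].
have := hn0 _ mem; rewrite leNgt => /negP; apply; apply: (lt_le_trans close).
apply: (@le_trans _ _ (b%:R ^- N)).
  by rewrite ler_pdivrMr ?ler_peMr ?invr_ge0 ?(ltW (bX_gt0 _)) //; lra.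
rewrite lef_pV2 ?posrE // ler_eXn2l //.
rewrite -(ler_nat R); have : 0 <= kappa * J%:R by apply: mulr_ge0.
by lra.
Qed.

(** Without divergence, p(n) - n is bounded for infinitely many n, which already makes right special
    words unique eventually. *)
Lemma complexity_diverges :
  (irrationality_exponent xi < (1 + kappa0 R)%:E)%E ->
  (fun n : nat => ((complexity n xi b)%:R - n%:R : R)) @ \oo --> +oo.
Proof.
move=> mu_lt; apply: contrapT => ndiv.
have [K hK] : exists K : nat, forall m, exists2 n, (m <= n)%N & (#|words digits n| <= n + K)%N.
  apply: contrapT => H; apply: ndiv; apply/cvgryPge => A.
  have [K hK] := nat_gt A.
  have : exists m, forall n, (m <= n)%N -> (n + K < #|words digits n|)%N.
    apply: contrapT => H1; apply: H; exists K => m; apply: contrapT => H2; apply: H1.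
    exists m => n mn; rewrite ltnNge; apply/negP => le; apply: H2; exists n => //.
  move=> [m hm]; exists m => // n /= mn; rewrite complexity_words.
  have := hm n mn; rewrite -(ltr_nat R) natrD; lra.
have [n0 sp] := special_unique_eventually digits_aperiodic hK.
have [kappa [k0 kk fin]] := exponent_finite mu_lt.
have [C hC] := repeats_bounded k0 fin.
exact: (repeats_unbounded digits_aperiodic sp k0 kk hC).
Qed.

End Digits.

(** * Upper bounds for the irrationality exponent *)

Lemma finite_rat_bounded (R : realType) (xi : R) (B : nat) :
  finite_set [set r : rat | denq r <= B%:Z /\ `| xi - ratr r | < 1].
Proof.
have [A hA] := nat_gt ((`|xi| + 1) * B%:R).
pose f (u : 'I_(2 * A).+1 * 'I_B.+1) : rat := ((u.1 : nat)%:Z - A%:Z)%:Q / (u.2 : nat)%:Q.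
apply: (@sub_finite_set _ _ (f @` setT)); last exact: finite_image.
move=> r /= [dB close].
have [q qE] : {q | denq r = q%:Z} by exists `|denq r|%N; rewrite gez0_abs ?denq_ge0.
have q0 : (0 < q)%N by rewrite -ltz_nat -qE denq_gt0.
have nA : `|numq r| <= A%:Z.
  rewrite -(ler_int R) intr_norm; apply/ltW/le_lt_trans/hA.
  have -> : (numq r)%:~R = ratr r * q%:R :> R.
    by rewrite -(ratr_int R (numq r)) numqE rmorphM /= qE -pmulrn ratr_nat.
  rewrite normrM (ger0_norm (x := q%:R)) //.
  apply: ler_pM => //; last by rewrite ler_nat -lez_nat -qE.
  have -> : ratr r = xi - (xi - ratr r) by ring.
  by apply: le_trans (ler_normB _ _) _; lra.
have i1 : (`|(numq r + A%:Z)%R| < (2 * A).+1)%N by lia.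
have i2 : (q < B.+1)%N by lia.
exists (Ordinal i1, Ordinal i2) => //; rewrite /f /= -[RHS]divq_num_den qE.
by congr (_%:~R / _); lia.
Qed.

Section Dense.
Variables (R : realType) (xi : R) (b : nat).
Hypothesis b2 : (2 <= b)%N.
Let digs := digits xi b2.

(** Distinct fractions differ by at least the inverse product of their denominators, and the
    unreduced one may be used for [approximant]. *)
Lemma rat_gap (r : rat) (i d : nat) : (0 < d)%N -> r <> approximant xi b i d ->
  1 <= (denq r)%:~R * (period_den b i d)%:R * `| ratr r - ratr (approximant xi b i d) | :> R.
Proof.
move=> d0 ne; have Q0 := period_den_gt0 b2 i d0.
set p : int := Num.floor (b%:R ^+ (i + d) * xi) - Num.floor (b%:R ^+ i * xi).
pose Q := period_den b i d; rewrite -/Q in Q0 *.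
have rE : approximant xi b i d = p%:Q / Q%:Q by [].
pose w : int := numq r * Q%:Z - p * denq r.
have Qn : Q%:Q != 0 :> rat by rewrite intr_eq0 eqz_nat -lt0n.
have w0 : w != 0.
  apply/eqP => /eqP; rewrite subr_eq0 => /eqP e; apply: ne; rewrite rE.
  have /(congr1 (fun v : int => v%:Q)) := e; rewrite !intrM numqE.
  have dn : (denq r)%:Q != 0 :> rat by rewrite intr_eq0 denq_eq0.
  by move=> h; apply: (mulIf dn); apply: (mulIf Qn); rewrite h; field.
have : 1 <= `|w%:~R| :> R by rewrite -intr_norm -[1]/(1%:~R) ler_int -gtz0_ge1 normr_gt0.
have -> : w%:~R = (denq r)%:~R * Q%:R * (ratr r - ratr (approximant xi b i d)) :> R.
  rewrite rE fmorph_div /= !ratr_int -pmulrn /w intrB !intrM.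
  rewrite -(ratr_int R (numq r)) numqE rmorphM /= ratr_int -pmulrn.
  have QR : Q%:R != 0 :> R by rewrite pnatr_eq0 -lt0n.
  by field.
rewrite normrM ger0_norm //; apply: mulr_ge0 => //.
by rewrite ler0z denq_ge0.
Qed.

(* A rational of denominator about b^M differs from at least one of the two approximants
   that [cover] provides. *)
Variables (kappa c : R) (M0 : nat).
Hypothesis k0 : 0 <= kappa.
Hypothesis cover : forall M, (M0 <= M)%N -> exists i d N i' d' N',
  [/\ [/\ (0 < d)%N, agree digs i (i + d) N, (M <= N)%N & (i + d)%:R <= kappa * M%:R + c],
      [/\ (0 < d')%N, agree digs i' (i' + d') N', (M <= N')%N & (i' + d')%:R <= kappa * M%:R + c] &
      approximant xi b i d <> approximant xi b i' d'].

Let b_gt1 : 1 < b%:R :> R. Proof. by rewrite ltr1n. Qed.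
Let b_gt0 : 0 < b%:R :> R. Proof. by rewrite ltr0n; lia. Qed.

(** Of the two approximants, take one different from [r]. By [rat_gap] it is far from [r], and since
    2q is at most b^M its distance to [xi] is less than half of that gap. *)
Lemma rational_distance (r : rat) M : (M0 <= M)%N ->
  2 * (denq r)%:~R <= b%:R ^+ M :> R ->
  1 < 2 * (denq r)%:~R * b%:R `^ (kappa * M%:R + c) * `| xi - ratr r |.
Proof.
move=> M0M qM.
have bM0 : 0 < b%:R ^+ M :> R by apply: exprn_gt0.
have q0 : 1 <= (denq r)%:~R :> R by rewrite -[1]/(1%:~R) ler_int -gtz0_ge1 denq_gt0.
have key i d N : (0 < d)%N -> agree digs i (i + d) N -> (M <= N)%N ->
    (i + d)%:R <= kappa * M%:R + c -> r <> approximant xi b i d ->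
    1 < 2 * (denq r)%:~R * b%:R `^ (kappa * M%:R + c) * `| xi - ratr r |.
  move=> d0 A MN Jle ne.
  have Q0 : 0 < (period_den b i d)%:R :> R by rewrite ltr0n period_den_gt0.
  have gap := rat_gap d0 ne.
  have := approximant_close d0 A; rewrite ltr_pdivlMr // => close.
  have close2 : `|xi - ratr (approximant xi b i d)| * (period_den b i d)%:R < b%:R ^- M.
    apply: lt_le_trans close _; rewrite lef_pV2 ?posrE ?exprn_gt0 // ler_eXn2l //.
  have close3 : (denq r)%:~R * (`|xi - ratr (approximant xi b i d)| * (period_den b i d)%:R) < 1 / 2.
    apply: (@lt_le_trans _ _ ((denq r)%:~R * b%:R ^- M)).
      by rewrite ltr_pM2l //; lra.
    by rewrite ler_pdivrMr //; lra.
  have tri : `|ratr r - ratr (approximant xi b i d)| <=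
      `|xi - ratr r| + `|xi - ratr (approximant xi b i d)|.
    have -> : ratr r - ratr (approximant xi b i d) =
      (xi - ratr (approximant xi b i d)) - (xi - ratr r) by ring.
    by apply: le_trans (ler_normB _ _) _; rewrite addrC.
  have QJ : (period_den b i d)%:R <= b%:R `^ (kappa * M%:R + c) :> R.
    apply: (@le_trans _ _ (b%:R ^+ (i + d))).
      by rewrite -natrX ler_nat period_den_le.
    by rewrite -powR_mulrn ?(ltW b_gt0) //; apply: ler_powR => //; apply: ltW.
  move: gap tri close3 QJ; set Q := _%:R; set q := _%:~R in q0 *; set B := _ `^ _.
  set u := `|ratr r - _|; set v := `|xi - ratr r|; set w := `|xi - _| => gap tri close3 QJ.
  have u0 : 0 <= v by apply: normr_ge0.
  have h1 : q * Q * u <= q * Q * (v + w).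
    by apply: ler_wpM2l => //; apply: mulr_ge0; [lra | rewrite /Q ltW].
  have h2 : q * v * Q <= q * v * B by apply: ler_wpM2l => //; apply: mulr_ge0 => //; lra.
  have h3 : q * Q * (v + w) = q * v * Q + q * (w * Q) by ring.
  have -> : 2 * q * B * v = 2 * (q * v * B) by ring.
  by lra.
have [i [d [N [i' [d' [N' [[d0 A MN J] [d0' A' MN' J'] ne]]]]]]] := cover M0M.
have [e|/eqP ne1] := eqVneq r (approximant xi b i d); last exact: key A MN J ne1.
by apply: key A' MN' J' _ => //; rewrite e.
Qed.

Lemma dense_irrational : irrational xi.
Proof.
move=> [r _ e].
have [n hn] := nat_gt (2 * (denq r)%:~R : R).
have := @rational_distance r (M0 + n) (leq_addr _ _).
rewrite e subrr normr0 mulr0 ltr10 => h; suff : false by []; apply: h.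
apply: le_trans (ltW hn) _; rewrite -natrX ler_nat.
by apply: leq_trans (leq_addl M0 n) _; apply: ltnW; apply: ltn_expl.
Qed.

(** For a denominator q with 2q > b^M0, choosing b^m between 2q and 2qb in [rational_distance] gives
    a distance above 1 / (2 K q^(1 + kappa)); a larger exponent then bounds q. *)
Lemma dense_exponent : (irrationality_exponent xi <= (1 + kappa)%:E)%E.
Proof.
apply: ge_ereal_sup => _ [mu inf <-]; rewrite lee_fin leNgt; apply/negP => mu_gt.
apply: inf.
pose K : R := (2 * b%:R) `^ kappa * b%:R `^ c.
have K0 : 0 < K by rewrite mulr_gt0 ?powR_gt0 ?mulr_gt0 //.
pose eps := mu - (1 + kappa); have e0 : 0 < eps by rewrite subr_gt0.
have [B hB] := nat_gt ((2 * K) `^ (eps^-1) + b%:R ^+ M0).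
apply: (@sub_finite_set _ _ _ _ (finite_rat_bounded xi B)) => r /= close.
have q1 : 1 <= (denq r)%:~R :> R by rewrite -[1]/(1%:~R) ler_int -gtz0_ge1 denq_gt0.
have mu0 : 0 <= mu by apply: le_trans (ltW mu_gt); rewrite addr_ge0.
split; last first.
  apply: lt_le_trans close _; rewrite powRN invf_le1 ?powR_gt0; try lra.
  by rewrite -[X in X <= _](powRr0 ((denq r)%:~R : R)); apply: ler_powR.
rewrite -(ler_int R) -pmulrn; apply/ltW/le_lt_trans/hB.
have [q qE] : {q | denq r = q%:Z} by exists `|denq r|%N; rewrite gez0_abs ?denq_ge0.
have KK0 : 0 <= (2 * K) `^ (eps^-1) by apply: powR_ge0.
case: (leqP (2 * q) (b ^ M0)) => qM.
  have : (2 * q)%:R <= (b ^ M0)%:R :> R by rewrite ler_nat.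
  rewrite natrM natrX qE -pmulrn => h.
  have : 0 <= q%:R :> R by []. lra.
have bM0 : 0 <= b%:R ^+ M0 :> R by apply: exprn_ge0; apply: ltW.
suff : (denq r)%:~R <= (2 * K) `^ (eps^-1) by lra.
have n0 : (0 < 2 * q)%N by rewrite muln_gt0 /= -ltz_nat -qE denq_gt0.
have b1 : (1 < b)%N by [].
have [m [m1 m2 m3]] : exists m, [/\ (M0 <= m)%N, (2 * q <= b ^ m)%N & (b ^ m <= 2 * q * b)%N].
  have /andP [l1 l2] := trunc_log_bounds b1 n0.
  exists (trunc_log b (2 * q)).+1; split.
  - rewrite leqNgt; apply/negP => lt; move: qM; rewrite ltnNge => /negP; apply.
    by apply: leq_trans (ltnW l2) _; rewrite leq_exp2l // ltnW.
  - exact: ltnW.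
  - by rewrite expnS mulnC leq_mul2r l1 orbT.
have := @rational_distance r m m1.
rewrite qE -pmulrn -natrX -[2 * _]natrM ler_nat => /(_ m2); rewrite natrM.
move: close; rewrite qE -pmulrn.
set v := `| _ |; set x : R := q%:R => close far.
have x1 : 1 <= x by rewrite /x pmulrn -qE.
have x0 : 0 < x by lra.
have B1 : b%:R `^ (kappa * m%:R + c) <= K * x `^ kappa.
  rewrite powRD; last by apply/implyP => _; rewrite gt_eqF.
  rewrite /K mulrAC ler_pM2r ?powR_gt0 // -powRM ?mulr_ge0 ?(ltW b_gt0) ?(ltW x0) //.
  rewrite mulrC powRrM powR_mulrn ?(ltW b_gt0) //.
  apply: ge0_ler_powR => //; rewrite ?nnegrE ?exprn_ge0 ?(ltW b_gt0) //.
    by rewrite !mulr_ge0 ?(ltW b_gt0) ?(ltW x0).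
  have : (b ^ m)%:R <= (2 * q * b)%:R :> R by rewrite ler_nat.
  by rewrite natrX (natrM _ (2 * q)) (natrM _ 2) -/x mulrAC.
have e1 : x `^ eps < 2 * K.
  have h1 : 1 < 2 * x * (K * x `^ kappa) * x `^ (- mu).
    apply: lt_le_trans far _.
    apply: ler_pM; rewrite ?normr_ge0 ?(ltW close) //.
      by apply: mulr_ge0; [lra | apply: powR_ge0].
    by apply: ler_wpM2l; [apply: mulr_ge0; rewrite ?(ltW x0) | exact: B1].
  have h2 : x `^ mu = x `^ eps * x `^ kappa * x.
    rewrite -[X in _ * X](powRr1 (ltW x0)) -!powRD; try by apply/implyP => _; rewrite gt_eqF.
    by congr (_ `^ _); rewrite /eps; ring.
  have m0 : 0 < x `^ mu by apply: powR_gt0.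
  move: h1; rewrite powRN -(ltr_pM2r m0) mul1r mulfVK ?gt_eqF // h2.
  have -> : x `^ eps * x `^ kappa * x = x `^ eps * (x * x `^ kappa) by ring.
  have -> : 2 * x * (K * x `^ kappa) = 2 * K * (x * x `^ kappa) by ring.
  by rewrite ltr_pM2r // mulr_gt0 ?powR_gt0.
have -> : x = (x `^ eps) `^ (eps^-1).
  by rewrite -powRrM divff ?gt_eqF // powRr1 // ltW.
apply: ge0_ler_powR; rewrite ?nnegrE ?invr_ge0 ?powR_ge0 ?(ltW e0) ?(ltW e1) //.
by apply: mulr_ge0 => //; apply: ltW.
Qed.

End Dense.

(** * The extremal number *)

(** [xi] is the supremum of the truncations [u n]. Later digits below [b - 1] make [xi < w n]
    strict, so that the floor of b^n xi is [v n]. *)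
Lemma digits_exist (R : realType) (b : nat) (d : nat -> nat) : (2 <= b)%N ->
  (forall l, d l < b)%N -> (forall n, exists2 m, n <= m & d m < b.-1)%N ->
  exists xi : R, forall l, digit xi b l.+1 = d l.
Proof.
move=> b2 db dinf.
have b_gt0 : 0 < b%:R :> R by rewrite ltr0n ltnW.
have bX n : 0 < b%:R ^+ n :> R by apply: exprn_gt0.
pose v := fix v n : nat := if n is n'.+1 then (b * v n' + d n')%N else 0%N.
pose u n : R := (v n)%:R / b%:R ^+ n.
pose w n : R := ((v n)%:R + 1) / b%:R ^+ n.
have uS n : u n <= u n.+1.
  rewrite /u ler_pdivrMr // mulrAC ler_pdivlMr // exprS mulrCA mulrA ler_pM2r //.
  by rewrite natrD natrM lerDl.
have wS n : w n.+1 <= w n.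
  rewrite /w ler_pdivrMr // mulrAC ler_pdivlMr // exprS mulrCA mulrA ler_pM2r //.
  by rewrite mulrDr mulr1 /= natrD natrM -addrA lerD2l natr1 ler_nat.
have wS_lt n : (d n < b.-1)%N -> w n.+1 < w n.
  move=> dn; rewrite /w ltr_pdivrMr // mulrAC ltr_pdivlMr // exprS mulrCA mulrA ltr_pM2r //.
  by rewrite mulrDr mulr1 /= natrD natrM -addrA ltrD2l natr1 ltr_nat; lia.
have uD n k : u n <= u (n + k)%N.
  by elim: k => [|k IH]; rewrite ?addn0 // addnS (le_trans IH).
have wD n k : w (n + k)%N <= w n.
  by elim: k => [|k IH]; rewrite ?addn0 // addnS (le_trans _ IH).
have uw n : u n <= w n by rewrite /u /w ler_pM2r ?invr_gt0 // lerDl.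
have uw2 n m : u n <= w m.
  case: (leqP n m) => nm.
    by apply: le_trans (uD n (m - n)%N) _; rewrite subnKC.
  by apply: le_trans (uw n) _; rewrite -(subnKC (ltnW nm)).
pose xi := sup (range u).
have u_xi n : u n <= xi.
  apply: ub_le_sup; last by exists n.
  by exists (w 0%N) => _ [m _ <-]; apply: uw2.
have xi_w n : xi <= w n.
  apply: ge_sup; first by exists (u 0%N), 0%N.
  by move=> _ [m _ <-]; apply: uw2.
have xi_w_lt n : xi < w n.
  have [m nm dm] := dinf n; apply: le_lt_trans (xi_w m.+1) _.
  by apply: lt_le_trans (wS_lt m dm) _; rewrite -(subnKC nm).
have fl n : Num.floor (b%:R ^+ n * xi) = (v n)%:Z.
  apply: floor_def; rewrite intrD -!pmulrn.
  have := u_xi n; have := xi_w_lt n.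
  by rewrite /u /w ltr_pdivlMr // ler_pdivrMr // mulrC => -> ->.
exists xi => l; apply/eqP; rewrite -eqz_nat digit_floor // !fl /= PoszD PoszM addrC addKr.
by [].
Qed.

Section Extremal.
Variables (R : realType) (xi : R) (b : nat).
Hypothesis b2 : (2 <= b)%N.
Hypothesis dxi : forall l, digit xi b l.+1 = fixword l.
Let digs := digits xi b2.

Let b_gt0 : 0 < b%:R :> R. Proof. by rewrite ltr0n ltnW. Qed.
Let b_gt1 : 1 < b%:R :> R. Proof. by rewrite ltr1n. Qed.
Let b_ge2 : 2 <= b%:R :> R. Proof. by rewrite ler_nat. Qed.

Lemma frac_fixword l : b%:R * frac xi b l = (fixword l)%:R + frac xi b l.+1.
Proof. by rewrite frac_step // dxi. Qed.

(** The worst case is base 2 with digits 10, giving at most 1/2 + 1/4, since no two consecutive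
    digits are 1. *)
Lemma frac_le l : frac xi b l <= 3 / 4.
Proof.
have := frac_fixword l; have := frac_fixword l.+1.
have /andP [h0 _] := frac_itv xi b l.
have /andP [h1 h1'] := frac_itv xi b l.+1.
have /andP [h2 h2'] := frac_itv xi b l.+2.
have g l' : 0 <= frac xi b l' -> 2 * frac xi b l' <= b%:R * frac xi b l'.
  by move=> h; apply: ler_wpM2r.
have := g _ h0; have := g _ h1.
case E: (fixword l); first by rewrite fixword_no_TT //=; lra.
by case: (fixword l.+1) => /=; lra.
Qed.

(** Multiplied by [b], the difference is at least 1 - 3/4 = 1/4, which is at least [b ^- 2]. *)
Lemma frac_differ l l' : fixword l <> fixword l' ->
  b%:R ^- 3 <= `| frac xi b l - frac xi b l' |.
Proof.
wlog : l l' / fixword l = true => [H|fl fl'].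
  case E: (fixword l); first by move=> ne; apply: H; rewrite ?E.
  by move=> ne; rewrite distrC; apply: H => //; [case: (fixword l') ne | rewrite E => /esym].
have := frac_fixword l; have := frac_fixword l'; rewrite fl.
have -> : fixword l' = false by move: fl'; rewrite fl; case: (fixword l').
have /andP [h1 _] := frac_itv xi b l.+1; have h2 := frac_le l'.+1.
move=> e1 e2; apply: le_trans (ler_norm _).
have h : 1 / 4 <= b%:R * (frac xi b l - frac xi b l') by rewrite mulrBr e1 e2 /=; lra.
rewrite -(ler_pM2l b_gt0); apply: le_trans h.
have -> : b%:R * b%:R ^- 3 = (b%:R * b%:R)^-1 :> R.
  by rewrite exprS expr2 invfM mulrA divff ?gt_eqF // mul1r.
rewrite div1r lef_pV2 ?posrE ?mulr_gt0 //.
have : 2 * 2 <= b%:R * b%:R :> R by apply: ler_pM.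
by lra.
Qed.

Lemma digs_differ l l' : digs l <> digs l' -> fixword l <> fixword l'.
Proof. by move=> ne e; apply: ne; apply: val_inj; rewrite /= !dxi e. Qed.

Lemma approximant_far i d N : xrepeat digs i d N ->
  b%:R ^- (i + d + N + 3) <= `| xi - ratr (approximant xi b i d) |.
Proof.
move=> [d0 A /digs_differ ne].
have Q0 : 0 < (period_den b i d)%:R :> R by rewrite ltr0n period_den_gt0.
have bX n : 0 < b%:R ^+ n :> R by apply: exprn_gt0.
have := frac_differ ne; rewrite -(frac_agree A) normrM (gtr0_norm (bX N)).
rewrite distrC -(approximant_error xi b2 i d0) normrM (gtr0_norm Q0).
set v := `| _ | => h.
have QJ : (period_den b i d)%:R <= b%:R ^+ (i + d) :> R by rewrite -natrX ler_nat period_den_le.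
have v0 : 0 <= v by apply: normr_ge0.
rewrite !exprD -[X in X <= _]mul1r ler_pdivrMr ?mulr_gt0 //.
have : b%:R ^- 3 * b%:R ^+ 3 <= b%:R ^+ N * ((period_den b i d)%:R * v) * b%:R ^+ 3 by rewrite ler_pM2r.
rewrite mulVf ?gt_eqF // => h1; apply: le_trans h1 _.
have -> : v * (b%:R ^+ i * b%:R ^+ d * b%:R ^+ N * b%:R ^+ 3) = b%:R ^+ N * (b%:R ^+ (i + d) * v) * b%:R ^+ 3.
  by rewrite exprD; ring.
by rewrite ler_pM2r // ler_pM2l // ler_wpM2r.
Qed.

(** With J = i + d, an exact repetition has error at least b^-(J+N+3) and below b^-(J+N-1), so a gap
    above 4 in J + N separates the errors. *)
Lemma approximant_neq i d N i' d' N' : xrepeat digs i d N -> xrepeat digs i' d' N' ->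
  (i + d + N + 4 < i' + d' + N')%N -> approximant xi b i d <> approximant xi b i' d'.
Proof.
move=> X [d0 A _] lt e; have := approximant_far X; rewrite e.
have := approximant_close d0 A.
have Q0 : 0 < (period_den b i' d')%:R :> R by rewrite ltr0n period_den_gt0.
have bX n : 0 < b%:R ^+ n :> R by apply: exprn_gt0.
have bXn n : (b ^ n != 0)%N by rewrite -lt0n expn_gt0 ltnW.
have Qge : (b ^ (i' + d').-1 <= period_den b i' d')%N.
  have -> : ((i' + d').-1 = i' + d'.-1)%N by lia.
  rewrite expnD leq_mul2l; apply/orP; right; rewrite -{2}(prednK d0) expnS.
  have := bXn d'.-1; set x := (b ^ d'.-1)%N => x0.
  have : (2 * x <= b * x)%N by rewrite leq_mul2r b2 orbT.
  by lia.
move=> close far; have := le_lt_trans far close; rewrite ltNge => /negP; apply.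
apply: (@le_trans _ _ (b%:R ^- N' / b%:R ^+ (i' + d').-1)).
  by rewrite ler_pM2l ?invr_gt0 // lef_pV2 ?posrE // -natrX ler_nat.
rewrite -invfM -exprD lef_pV2 ?posrE // ler_eXn2l //.
by lia.
Qed.

(** The quadruple (a, b, P, S) of each stage; at stage 0 the blocks are single digits. *)
Definition state := fix state k : nat * nat * nat * nat :=
  if k is k'.+1 then let: (a, b, p, s) := state k' in
    (3 * a + 5 * b, 2 * a + 3 * b, p + 4 * a + 6 * b, s + b)%N
  else (1, 1, 0, 0)%N.

Let sa k := (state k).1.1.1.
Let sb k := (state k).1.1.2.
Let sP k := (state k).1.2.
Let sS k := (state k).2.

Let stateS k : [/\ sa k.+1 = 3 * sa k + 5 * sb k, sb k.+1 = 2 * sa k + 3 * sb k,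
  sP k.+1 = sP k + 4 * sa k + 6 * sb k & sS k.+1 = sS k + sb k]%N.
Proof. by rewrite /sa /sb /sP /sS /=; case: (state k) => [[[]]]. Qed.

Let state_inv k : [/\ 0 < sa k, 0 < sb k, sP k + sS k + 2 = sa k + sb k & sS k <= sa k]%N
  /\ [/\ sS k <= sb k, 3 * sP k + 6 = 2 * sa k + 4 * sb k, sa k <= 4 * sb k, k <= sP k & k <= sb k]%N.
Proof.
elim: k => // k; have [-> -> -> ->] := stateS k.
move=> [[h1 h2 h3 h4] [h5 h6 h7 h8 h9]]; split; split; lia.
Qed.

Lemma state_blocks k : exists e, xblocks digs (sa k) (sb k) (sP k) (sS k) fixword e.
Proof.
elim: k => [|k [e X]].
  exists id; split; last first.
    move=> k k' ne; rewrite !addn0 => /(congr1 val) /=; rewrite !dxi.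
    by case: (fixword k) (fixword k') ne => [] [].
  split=> //.
  - by move=> k; rewrite /sa /sb /=; case: (fixword k); rewrite addn1.
  - move=> k k' ekk' t; have -> : (if fixword k then sa 0 else sb 0) = 1%N by case: (fixword k).
    by move: t => [|//] _; rewrite !addn0; apply: val_inj; rewrite /= !dxi ekk'.
have [-> -> -> ->] := stateS k.
by eexists; apply: xblocks_step X.
Qed.

Let stage M : (sP 1 < M)%N -> exists k, [/\ (1 <= k)%N, (sP k < M)%N & (M <= sP k.+1)%N].
Proof.
move=> M1; have ex : exists k, (M <= sP k)%N by exists M; have [_ []] := state_inv M.
case: (ex_minnP ex) => k Mk kmin.
have k2 : (2 <= k)%N by case: k Mk {kmin} => [|[|k]] //; rewrite /sP /= in M1 *; lia.
exists k.-1; rewrite prednK; last lia; split=> //; first lia.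
by rewrite ltnNge; apply/negP => /kmin; lia.
Qed.

(** Locate [M] among the values N of consecutive records and take the next two; their J are the N of
    the preceding ones, up to constants. *)
Lemma double_cover M : (sP 1 < M)%N -> exists i d N i' d' N',
  [/\ xrepeat digs i d N, xrepeat digs i' d' N', (M <= N)%N /\ (M <= N')%N,
      (i + d + N + 4 < i' + d' + N')%N &
      (2 * (i + d) <= 3 * M + 20 /\ 2 * (i' + d') <= 3 * M + 20)%N \/
      exists k, [/\ (sa k <= M + 2)%N, (i + d <= sP k + 2)%N & (i' + d' <= sP k + 2)%N]].
Proof.
move=> /stage [k [k1 PM MP]].
have [[a0 b0 PS Sa] [Sb PE ab _ kb]] := state_inv k.
have [e X] := state_blocks k.
have b3 : (3 <= sb k)%N.
  case: k k1 {PM MP a0 b0 PS Sa Sb PE ab kb X} => // k _.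
  by have [_ -> _ _] := stateS k; have [[? ? _ _] _] := state_inv k; lia.
have r2 := record2 X Sa a0 b0; have r3 := record3 X Sa a0 b0; have r4 := record4 X Sa a0 b0.
have r5 := record5 X Sa a0 b0; have r6 := record6 X Sa a0 b0.
have [[a0' b0' PS' Sa'] [Sb' PE' ab' _ kb']] := state_inv k.+1.
have [e' X'] := state_blocks k.+1.
have r7 := record1 X' Sa' a0' b0'; have r8 := record2 X' Sa' a0' b0'.
have [ea eb eP eS] := stateS k.
case: (leqP M (sS k + sb k + sP k)) => M2.
  by do 6!eexists; split; [exact: r2 | exact: r3 | lia | lia | left; lia].
case: (leqP M (sa k + sb k + sP k)) => M3.
  by do 6!eexists; split; [exact: r3 | exact: r4 | lia | lia | left; lia].
case: (leqP M (sS k + sb k + (sa k + sb k) + sP k)) => M4.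
  by do 6!eexists; split; [exact: r4 | exact: r5 | lia | lia | left; lia].
case: (leqP M (2 * sa k + 3 * sb k + sP k)) => M5.
  by do 6!eexists; split; [exact: r5 | exact: r6 | lia | lia | left; lia].
case: (leqP M (sS k + sb k + (2 * sa k + 3 * sb k) + sP k)) => M6.
  by do 6!eexists; split; [exact: r6 | exact: r7 | lia | lia | left; lia].
(* The only case not covered by the ratio 3/2: [M] is near the new a while J of [record2] is P +
   2. *)
by do 6!eexists; split; [exact: r7 | exact: r8 | lia | lia | right; exists k.+1; split; lia].
Qed.

Let kappa0_ge : 3 / 2 <= kappa0 R.
Proof.
rewrite /kappa0.
set s := Num.sqrt 10; have ss : s ^+ 2 = 10 by rewrite sqr_sqrtr.
have s0 : 0 <= s by apply: sqrtr_ge0.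
(* 25/8 solves 2/3 + 4/15 s = 3/2. *)
suff : 25 / 8 <= s by lra.
rewrite leNgt; apply/negP => lt.
have : s * s <= 25 / 8 * (25 / 8) by apply: ler_pM => //; apply: ltW.
by rewrite -expr2 ss; lra.
Qed.

Lemma extremal_cover : exists c : R, forall M, ((sP 1).+1 <= M)%N -> exists i d N i' d' N',
  [/\ [/\ (0 < d)%N, agree digs i (i + d) N, (M <= N)%N & (i + d)%:R <= kappa0 R * M%:R + c],
      [/\ (0 < d')%N, agree digs i' (i' + d') N', (M <= N')%N & (i' + d')%:R <= kappa0 R * M%:R + c] &
      approximant xi b i d <> approximant xi b i' d'].
Proof.
have hs j : [/\ sa j.+1 = (3 * sa j + 5 * sb j)%N,
  sb j.+1 = (2 * sa j + 3 * sb j)%N & sP j.+1 = (sP j + 4 * sa j + 6 * sb j)%N].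
  by have [] := stateS j.
have sa0 j : (0 < sa j)%N by have [[]] := state_inv j.
have sb0 j : (0 < sb j)%N by have [[]] := state_inv j.
have [D hD] := period_ratio R sa0 sb0 hs.
have D0 : 0 <= D by apply: le_trans (hD 0%N).
(* 10 serves the 3/2 cases, 4/15 D comes from [period_ratio], and the rest from the offsets in M + 2
   and P + 2. *)
exists (10 + 4 / 15 * D + 2 * kappa0 R + 2) => M /double_cover.
move=> [i [d [N [i' [d' [N' [X X' [MN MN'] gap J]]]]]]].
exists i, d, N, i', d', N'.
have ne := approximant_neq X X' gap.
have [d0 A _] := X; have [d0' A' _] := X'.
have M0 : 0 <= M%:R :> R by [].
have half n : (2 * n <= 3 * M + 20)%N -> n%:R <= kappa0 R * M%:R + (10 + 4 / 15 * D + 2 * kappa0 R + 2).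
  rewrite -(ler_nat R) natrM natrD natrM => h.
  have : 3 / 2 * M%:R <= kappa0 R * M%:R by apply: ler_wpM2r.
  by have := kappa0_ge; lra.
have tight k n : (sa k <= M + 2)%N -> (n <= sP k + 2)%N ->
    n%:R <= kappa0 R * M%:R + (10 + 4 / 15 * D + 2 * kappa0 R + 2).
  rewrite -!(ler_nat R) !natrD => h1 h2.
  have [_ [_ PE _ _ _]] := state_inv k.
  have : 3 * (sP k)%:R + 6 = 2 * (sa k)%:R + 4 * (sb k)%:R :> R.
    by rewrite -!natrM -!natrD PE.
  have := hD k; rewrite ler_norml => /andP [_ h3] h4.
  have : kappa0 R * (sa k)%:R <= kappa0 R * (M%:R + 2).
    by apply: ler_wpM2l => //; have := kappa0_ge; lra.
  have -> : kappa0 R * (sa k)%:R = 2 / 3 * (sa k)%:R + 4 / 15 * (Num.sqrt 10 * (sa k)%:R).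
    by rewrite /kappa0; ring.
  rewrite mulrDr; have := kappa0_ge.
  by lra.
split=> //; split=> //.
- by case: J => [[h _]|[k [h1 h2 _]]]; [exact: half | exact: (tight k)].
- by case: J => [[_ h]|[k [h1 _ h2]]]; [exact: half | exact: (tight k)].
Qed.

Lemma extremal_irrational : irrational xi.
Proof.
have [c cover] := extremal_cover.
have k0 : 0 <= kappa0 R by have := kappa0_ge; lra.
exact: (dense_irrational k0 cover).
Qed.

(** A smaller exponent would bound all repetitions by some kappa below [kappa0], but [record1] has
    (J, N) = (a, P), which escapes. *)
Lemma extremal_exponent : irrationality_exponent xi = (1 + kappa0 R)%:E.
Proof.
have k0 : 0 < kappa0 R by have := kappa0_ge; lra.
apply/eqP; rewrite eq_le; apply/andP; split.
  have [c cover] := extremal_cover.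
  exact: (dense_exponent (ltW k0) cover).
rewrite leNgt; apply/negP => lt.
have [kappa [kp kk fin]] := exponent_finite lt.
have [C hC] := repeats_bounded b2 extremal_irrational kp fin.
have hs j : [/\ sa j.+1 = (3 * sa j + 5 * sb j)%N,
  sb j.+1 = (2 * sa j + 3 * sb j)%N & sP j.+1 = (sP j + 4 * sa j + 6 * sb j)%N].
  by have [] := stateS j.
have sa0 j : (0 < sa j)%N by have [[]] := state_inv j.
have sb0 j : (0 < sb j)%N by have [[]] := state_inv j.
have [j] := period_escape sa0 sb0 hs C kk.
rewrite ltNge => /negP; apply; apply: hC.
have [e X] := state_blocks j; have [[a0 b0 _ Sa] _] := state_inv j; have [d0 A _] := record1 X Sa a0 b0.
by exists 0%N, (sa j).
Qed.

(** The word count starts at 1 and grows by at least one per step; [xblocks_words] bounds it by P +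
    2 at arbitrarily large lengths P + 1, leaving no room for a larger step. *)
Lemma extremal_complexity n : complexity n xi b = n.+1.
Proof.
rewrite (complexity_words xi b2).
have lt k := card_words_ltS k (digits_aperiodic b2 extremal_irrational).
have mono k d : (#|words digs k| + d <= #|words digs (k + d)|)%N.
  by elim: d => [|d IH]; rewrite ?addn0 // !addnS; have := lt (k + d)%N; rewrite -/digs; lia.
have := mono 0%N n; rewrite add0n card_words0.
have [[a0 b0 PS Sa] [Sb _ _ nP _]] := state_inv n.
have [e X] := state_blocks n.
have := xblocks_words X Sa Sb a0 b0 PS; have := mono n ((sP n).+1 - n)%N.
by rewrite subnKC -/digs; lia.
Qed.

End Extremal.

Theorem theorem4p6 (R : realType) :
  (forall xi : R, irrational xi ->
     (irrationality_exponent xi < (5 / 3 + 4 / 15 * Num.sqrt 10)%:E)%E ->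
     forall b : nat, (2 <= b)%N ->
       (fun n : nat => ((complexity n xi b)%:R - n%:R : R)) @ \oo --> +oo)
  /\
  (forall b : nat, (2 <= b)%N ->
     exists xib : R, irrational xib /\
       irrationality_exponent xib = (5 / 3 + 4 / 15 * Num.sqrt 10)%:E /\
       forall n : nat, (1 <= n)%N -> complexity n xib b = n.+1).
Proof.
have -> : 5 / 3 + 4 / 15 * Num.sqrt 10 = 1 + kappa0 R by rewrite /kappa0; lra.
split=> [xi irr mu b b2 | b b2]; first exact: complexity_diverges.
have [|n|xi dxi] := @digits_exist R b (fun l => fixword l : nat) b2.
- by move=> l; case: (fixword l) => /=; lia.
(* For base 2 a 0 is required, and one of two consecutive letters is 0. *)
- case E: (fixword n); last by exists n; rewrite // E; lia.
  by exists n.+1; rewrite // (fixword_no_TT E); lia.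
exists xi; split; first exact: extremal_irrational dxi.
split; first exact: extremal_exponent dxi.
by move=> n _; apply: extremal_complexity dxi n.
Qed.
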